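(* Let $p$ be a prime, $d\ge2$ an integer, and $(t_n)_{n\ge1}$ a sequence of positive integers with $t_n\le n$. For each $n$ let $\sigma_{n,i}=[t_n+(\lceil i/d\rceil-1)]$ for $1\le i\le d(n-t_n)$ and $\sigma_{n,i}=[n]$ for $i\ge d(n-t_n)+1$ (with $i\le n$), and let $X_n$ be a Haar-random matrix in $\mathrm{M}_n(\mathbb{Z}_p)$ supported on $\Sigma_n=(\sigma_{n,1},\ldots,\sigma_{n,n})$. If $\lim_{n\to\infty}(n-d(n-t_n))=\infty$, then $\mathrm{cok}(X_n)$ converges to CL.
   Context: $[m]=\{1,\ldots,m\}$. A Haar-random matrix supported on $\Sigma_n$ has $(X_n)_{i,j}=0$ for $i\notin\sigma_{n,j}$ and independent Haar-distributed entries $(X_n)_{i,j}$ for $i\in\sigma_{n,j}$. $\mathrm{cok}(X_n)$ converges to CL means: for every finite abelian $p$-group $H$, $\lim_{n\to\infty}\mathbb{P}(\mathrm{cok}(X_n)\cong H)=\frac{1}{|\mathrm{Aut}(H)|}\prod_{i=1}^\infty(1-p^{-i})$. *)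

(* Defs.v *)
From HB Require Import structures.
From mathcomp Require Import all_boot all_order all_algebra all_fingroup.
From mathcomp Require Import all_solvable.
From mathcomp Require Import ring_quotient.
From mathcomp Require Import all_classical all_reals all_analysis.

Set Implicit Arguments.
Unset Strict Implicit.
Unset Printing Implicit Defensive.

Import Order.TTheory GRing.Theory Num.Theory.
Import numFieldNormedType.Exports.

Local Open Scope classical_set_scope.
Local Open Scope ring_scope.

(* Z_p as the inverse limit of the rings Z/p^(k+1), k >= 0; the exponent starts
   at 1 because 'Z_(p ^ 0) is Z/2 in MathComp. *)
Record padic_int (p : nat) := PadicInt {
  padic_mod :> forall k : nat, 'Z_(p ^ k.+1);
  padic_modP : forall k, ((padic_mod k.+1 : nat)%:R : 'Z_(p ^ k.+1)) = padic_mod k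
}.

Section PadicRing.
Variable p : nat.
Notation Zp := (padic_int p).

Lemma padic_ext (x y : Zp) : (forall k, x k = y k) -> x = y.
Proof.
case: x y => [x xP] [y yP] /= exy.
have {}exy : x = y by apply: functional_extensionality_dep.
by subst y; congr PadicInt; apply: Prop_irrelevance.
Qed.

Lemma Zp_trunc_dvd k :
  ((Zp_trunc (p ^ k.+1)).+2 %| (Zp_trunc (p ^ k.+2)).+2)%N.
Proof.
case: p => [|[|q]]; first by rewrite !exp0n.
  by rewrite !exp1n.
have gt1 j : (1 < q.+2 ^ j.+1)%N by rewrite -(expn0 q.+2) ltn_exp2l.
by rewrite !Zp_cast// dvdn_exp2l.
Qed.

Lemma eq_natr_Zp m a b : a = b %[mod (Zp_trunc m).+2] ->
  (a%:R : 'Z_m) = b%:R.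
Proof. by move=> ab; apply: val_inj; rewrite !Zp_nat. Qed.

Lemma natr_modZp m (d a : nat) : ((Zp_trunc m).+2 %| d)%N ->
  ((a %% d)%N%:R : 'Z_m) = a%:R.
Proof. by move=> md; apply: eq_natr_Zp; rewrite modn_dvdm. Qed.

Lemma padic_add_subproof (x y : Zp) k :
  ((val (x k.+1 + y k.+1)%R)%:R : 'Z_(p ^ k.+1)) = x k + y k.
Proof. by rewrite /= natr_modZp ?Zp_trunc_dvd// natrD !padic_modP. Qed.

Lemma padic_mul_subproof (x y : Zp) k :
  ((val (x k.+1 * y k.+1)%R)%:R : 'Z_(p ^ k.+1)) = x k * y k.
Proof. by rewrite /= natr_modZp ?Zp_trunc_dvd// natrM !padic_modP. Qed.

Lemma padic_zero_subproof k :
  ((val (0%R : 'Z_(p ^ k.+2)))%:R : 'Z_(p ^ k.+1)) = 0.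
Proof. by []. Qed.

Lemma padic_one_subproof k :
  ((val (1%R : 'Z_(p ^ k.+2)))%:R : 'Z_(p ^ k.+1)) = 1.
Proof. by rewrite /= natr_modZp ?Zp_trunc_dvd. Qed.

Lemma padic_opp_subproof (x : Zp) k :
  ((val (- x k.+1)%R)%:R : 'Z_(p ^ k.+1)) = - x k.
Proof.
apply/eqP; rewrite -addr_eq0 -[in X in _ + X](padic_modP x k) -natrD.
have := congr1 val (addNr (x k.+1)); rewrite /= => h.
by rewrite -(natr_modZp _ (Zp_trunc_dvd k)) h.
Qed.

Definition padic_add (x y : Zp) := PadicInt (padic_add_subproof x y).
Definition padic_mul (x y : Zp) := PadicInt (padic_mul_subproof x y).
Definition padic_opp (x : Zp) := PadicInt (padic_opp_subproof x).
Definition padic_zero : Zp := PadicInt padic_zero_subproof.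
Definition padic_one : Zp := PadicInt padic_one_subproof.

HB.instance Definition _ := gen_eqMixin Zp.
HB.instance Definition _ := gen_choiceMixin Zp.

Fact padic_addA : associative padic_add.
Proof. by move=> x y z; apply: padic_ext => k /=; rewrite addrA. Qed.
Fact padic_addC : commutative padic_add.
Proof. by move=> x y; apply: padic_ext => k /=; rewrite addrC. Qed.
Fact padic_add0 : left_id padic_zero padic_add.
Proof. by move=> x; apply: padic_ext => k /=; rewrite add0r. Qed.
Fact padic_addN : left_inverse padic_zero padic_opp padic_add.
Proof. by move=> x; apply: padic_ext => k /=; rewrite addNr. Qed.
HB.instance Definition _ :=
  GRing.isZmodule.Build Zp padic_addA padic_addC padic_add0 padic_addN.

Fact padic_mulA : associative padic_mul.
Proof. by move=> x y z; apply: padic_ext => k /=; rewrite mulrA. Qed.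
Fact padic_mulC : commutative padic_mul.
Proof. by move=> x y; apply: padic_ext => k /=; rewrite mulrC. Qed.
Fact padic_mul1 : left_id padic_one padic_mul.
Proof. by move=> x; apply: padic_ext => k /=; rewrite mul1r. Qed.
Fact padic_mulDl : left_distributive padic_mul +%R.
Proof. by move=> x y z; apply: padic_ext => k /=; rewrite mulrDl. Qed.
Fact padic_one_neq0 : padic_one != 0.
Proof.
apply/eqP => /(congr1 (fun x : Zp => x 0%N)) /= /eqP.
by rewrite (negbTE (oner_neq0 _)).
Qed.
HB.instance Definition _ := GRing.Zmodule_isComNzRing.Build Zp
  padic_mulA padic_mulC padic_mul1 padic_mulDl padic_one_neq0.

HB.instance Definition _ := isPointed.Build Zp 0.

(* p-adic topology: y k = x k means y = x mod p^(k+1). *)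
Definition padic_open (U : set Zp) :=
  forall x, U x -> exists k, forall y : Zp, y k = x k -> U y.

Lemma padic_mod_le (x y : Zp) j k : (j <= k)%N -> x k = y k -> x j = y j.
Proof.
elim: k => [|k IH]; first by rewrite leqn0 => /eqP->.
rewrite leq_eqVlt => /orP[/eqP-> //|jk xy]; apply: IH => //.
by rewrite -(padic_modP x) -(padic_modP y) xy.
Qed.

Fact padic_openT : padic_open setT.
Proof. by move=> x _; exists 0%N. Qed.
Fact padic_openI (A B : set Zp) :
  padic_open A -> padic_open B -> padic_open (A `&` B).
Proof.
move=> oA oB x [/oA[j jA] /oB[k kB]]; exists (maxn j k) => y yx; split.
  by apply: jA; apply: padic_mod_le yx; rewrite leq_maxl.
by apply: kB; apply: padic_mod_le yx; rewrite leq_maxr.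
Qed.
Fact padic_open_bigU (I : Type) (f : I -> set Zp) :
  (forall i, padic_open (f i)) -> padic_open (\bigcup_i f i).
Proof.
by move=> of_ x [i _ /(of_ i)[k kf]]; exists k => y /kf fy; exists i.
Qed.
HB.instance Definition _ :=
  isOpenTopological.Build Zp padic_openT padic_openI padic_open_bigU.

(* Borel sigma-algebra *)
HB.instance Definition _ := @isMeasurable.Build
  (sigma_display (@open Zp)) Zp <<s @open Zp >>
  (@sigma_algebra0 _ setT (@open Zp)) (@sigma_algebraC _ (@open Zp))
  (@sigma_algebra_bigcup _ setT (@open Zp)).

End PadicRing.

Section Cokernel.
Variables (R : comNzRingType) (n : nat) (A : 'M[R]_n).

Definition colspan : {pred 'cV[R]_n} :=
  fun v => `[< exists u : 'cV[R]_n, v = A *m u >].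

Fact colspan_zmod_closed : zmod_closed colspan.
Proof.
split=> [|v w /asboolP[u ->] /asboolP[u' ->]]; apply/asboolP.
  by exists 0; rewrite mulmx0.
by exists (u - u'); rewrite mulmxBr.
Qed.
HB.instance Definition _ :=
  GRing.isZmodClosed.Build _ colspan colspan_zmod_closed.

Definition cok : zmodType := Quotient.quot colspan.

End Cokernel.

Definition zmod_iso (U V : zmodType) :=
  exists f : {additive U -> V}, bijective f.

Section Haar.
Context (d : measure_display) (Omega : measurableType d) (R : realType).
Variable P : probability Omega R.

(* The law of Y is a translation-invariant Borel probability measure on Z_p,
   i.e. the normalized Haar measure. *)
Definition haar_distributed (p : nat) (Y : Omega -> padic_int p) :=
  measurable_fun setT Y /\
  forall (a : padic_int p) (A : set (padic_int p)), measurable A ->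
    pushforward P Y [set a + x | x in A] = pushforward P Y A.

Definition mutually_independent (d' : measure_display) (T : measurableType d')
    (I : finType) (D : {set I}) (Y : I -> Omega -> T) :=
  forall (J : {set I}) (A : I -> set T), J \subset D ->
    (forall i, measurable (A i)) ->
    P (\bigcap_(i in [set` J]) Y i @^-1` A i) =
      (\prod_(i in J) P (Y i @^-1` A i))%E.

Definition haar_random_matrix (p n : nat) (Sigma : 'I_n -> {set 'I_n})
    (X : Omega -> 'M[padic_int p]_n) :=
  [/\ forall i j, i \notin Sigma j -> forall w, X w i j = 0,
      forall i j, i \in Sigma j -> haar_distributed (fun w => X w i j)
    & mutually_independent [set ij : 'I_n * 'I_n | ij.1 \in Sigma ij.2]%SET
        (fun ij w => X w ij.1 ij.2)].

End Haar.

Definition converges_to_CL (R : realType) (p : nat) (d : nat -> measure_display)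
    (Omega : forall n, measurableType (d n))
    (P : forall n, probability (Omega n) R)
    (X : forall n, Omega n -> 'M[padic_int p]_n) :=
  forall H : finZmodType, (p.-group [set: H]%G)%g ->
    P n [set w | zmod_iso (cok (X n w)) H] @[n --> \oo] -->
      ((#|Aut [set: H]%G|%:R^-1 *
        limn (fun m => \prod_(1 <= i < m.+1) (1 - (p%:R : R) ^- i)))%:E).

Definition ceil_div (a b : nat) : nat := (a %/ b + ~~ (b %| a))%N.

(* [m] := {1, ..., m} inside {1, ..., n}: the ordinal i stands for i + 1. *)
Definition initial (n m : nat) : {set 'I_n} := [set i : 'I_n | (i.+1 <= m)%N]%SET.

(* The column index j : 'I_n stands for i = j + 1. *)
Definition staircase (d t n : nat) (j : 'I_n) : {set 'I_n} :=
  if (j.+1 <= d * (n - t))%N then initial n (t + (ceil_div j.+1 d - 1))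
  else initial n n.

(* Main.v *)
(* For a finite abelian p-group H killed by p^k, whether cok(X) is isomorphic to
   H only depends on X modulo p^(k+1), which is uniform among the matrices over
   Z/p^(k+1) with the given support.  Presentations of a cokernel isomorphic to H
   are surjections f onto H whose kernel N is the column span, and each cokernel
   has |Aut H| of them.  Given f, the j-th column lies in N_j, the part of N
   supported on the first s_j coordinates, with probability 1/|f(Z^(s_j))|; the
   columns generate N iff they do so modulo pN, and N_j has dimension s_j there,
   so conditionally on this, they do with probability
   prod_j (1 - p^(j - s_j)), whatever f is.  Thus P(cok(X) ~ H) is exactly
     |Aut H|^-1 * prod_j (1 - p^(j - s_j)) * sum_f prod_j 1/|f(Z^(s_j))|.
   Writing m = n - d(n - t), the full columns contribute prod_(1 <= i <= m)
   (1 - p^-i) to the product and the others 1 + O(2^-m), while a recursion on the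
   rows shows that the sum is 1 + O(2^-m). *)
Require Import Defs.
From HB Require Import structures.
From mathcomp Require Import all_boot all_order all_algebra all_fingroup.
From mathcomp Require Import all_solvable.
From mathcomp Require Import lra ring zify.

Set Implicit Arguments.
Unset Strict Implicit.
Unset Printing Implicit Defensive.

Import Order.TTheory GRing.Theory Num.Theory.

Local Open Scope ring_scope.

(** * Spanning families in abelian p-groups *)

Lemma sum_tuple0 (V : nmodType) (T : finType) (F : seq T -> V) :
  \sum_(s : 0.-tuple T) F s = F [::].
Proof.
rewrite (big_pred1 [tuple]) // => c; apply/esym/eqP.
exact: tuple0.
Qed.

Lemma sum_tuple_rcons (V : nmodType) (T : finType) m (F : seq T -> V) :
  \sum_(s : m.+1.-tuple T) F s = \sum_(s : m.-tuple T) \sum_x F (rcons s x).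
Proof.
rewrite pair_big /=.
rewrite (reindex (fun u : m.-tuple T * T => [tuple of rcons u.1 u.2])) //=.
apply: onW_bij; apply: inj_card_bij; last first.
  by rewrite card_prod !card_tuple expnSr.
move=> [s x] [s' x'] /(congr1 val) /= /rcons_inj [ss ->].
by congr (_, _); apply: val_inj.
Qed.

Section FrattiniCount.
Local Open Scope group_scope.
Context (gT : finGroupType) (p : nat) (N : {group gT}).
Hypotheses (p_pr : prime p) (abN : abelian N) (pN : p.-group N).
Local Notation Phi := 'Mho^1(N).

Lemma Phi_abelian_pgroup : 'Phi(N) = Phi.
Proof. by rewrite (Phi_joing pN) (derG1P abN) joing1G. Qed.

(** For [c] in [N], this is the preimage in [N] of the span of [c] in the quotient [N / Phi], a
    vector space over the field with [p] elements. Dimensions become orders of subgroups. *)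
Definition frattini_span (c : seq gT) : {group gT} :=
  <<[set x in c]>> <*> Phi.

Lemma frattini_span_sub c : {subset c <= N} -> frattini_span c \subset N.
Proof.
move=> cN; rewrite join_subG gen_subG Mho_sub andbT.
by apply/subsetP => x; rewrite inE => /cN.
Qed.

(** Burnside's basis theorem: [Phi] is the Frattini subgroup, whose elements are non-generators. *)
Lemma frattini_span_full c : {subset c <= N} ->
  (frattini_span c == N :> {set gT}) = (<<[set x in c]>> == N :> {set gT}).
Proof.
move=> cN; apply/eqP/eqP => [h|h].
  apply: Phi_nongen; rewrite Phi_abelian_pgroup joingC -joing_idl.
  exact: h.
by rewrite /= h; apply/joing_idPl; rewrite Mho_sub.
Qed.

Lemma frattini_span_rcons c x :
  frattini_span (rcons c x) = <[x]> <*> frattini_span c :> {set gT}.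
Proof.
rewrite /= joingA; congr (_ <*> _).
have -> : [set y in rcons c x] = [set x] :|: [set y in c].
  by apply/setP => y; rewrite !inE mem_rcons inE.
by rewrite joing_idl joing_idr.
Qed.

(** Since [x ^+ p] lies in [Phi], a vector outside the span raises the dimension modulo [Phi] by
    exactly one. *)
Lemma card_frattini_span_rcons c x : {subset c <= N} -> x \in N ->
  #|frattini_span (rcons c x)| =
    ((if x \in frattini_span c then 1 else p) * #|frattini_span c|)%N.
Proof.
move=> cN xN; rewrite frattini_span_rcons.
set W := frattini_span c.
have WN : W \subset N := frattini_span_sub cN.
case: ifPn => xW.
  by rewrite mul1n; congr #|(_ : {set _})|; apply/joing_idPr; rewrite cycle_subG.
have xpW : x ^+ p \in W.
  apply: (subsetP (joing_subr _ _)).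
  by rewrite -[p in x ^+ p]expn1; apply: Mho_p_elt xN (mem_p_elt pN xN).
have nWx : <[x]> \subset 'N(W).
  by apply: subset_trans (sub_abelian_norm abN WN); rewrite cycle_subG.
have nWY : <[x]> <*> W \subset 'N(W) by rewrite join_subG nWx normG.
(* The quotient is generated by the coset of [x], whose order divides [p] and is not 1. *)
have cardq : #|(<[x]> <*> W) / W| = p.
  rewrite quotientYidr// quotient_cycle; last by rewrite -cycle_subG.
  apply/eqP; have/primeP[_ h] := p_pr.
  have /h/orP[|//] : (#[coset W x] %| p)%N.
    rewrite order_dvdn -morphX /=; last by rewrite -cycle_subG.
    by rewrite coset_id.
  rewrite order_eq1 => /eqP /(coset_idr _) h1; case/negP: xW; apply: h1.
  by rewrite -cycle_subG.
rewrite -[in RHS]cardq card_quotient//.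
by rewrite mulnC Lagrange ?joing_subr.
Qed.

Lemma card_frattini_span_le c : {subset c <= N} ->
  (#|frattini_span c| <= p ^ size c * #|Phi|)%N.
Proof.
elim/last_ind: c => [|c x IH] cN.
  rewrite mul1n /= subset_leq_card// join_subG subxx andbT.
  by rewrite gen_subG; apply/subsetP => x; rewrite inE.
have cN' : {subset c <= N} by move=> y yc; apply: cN; rewrite mem_rcons inE yc orbT.
rewrite card_frattini_span_rcons//; last by apply: cN; rewrite mem_rcons mem_head.
rewrite size_rcons expnS -mulnA leq_mul ?IH//.
by case: ifP => // _; rewrite prime_gt0.
Qed.

(** The modular law gives [(M :&: W) * Phi = W] for the span [W], and the product formula concludes.
    Hence how many elements of [M] lie in the span depends only on the order of the span. *)
Lemma card_frattini_span_capl (M : {group gT}) c :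
  M \subset N -> {subset c <= M} ->
  (#|M :&: frattini_span c| * #|Phi| = #|frattini_span c| * #|M :&: Phi|)%N.
Proof.
move=> MN cM; set W := frattini_span c.
have PhiW : Phi \subset W by apply: joing_subr.
have WMP : W \subset M * Phi.
  rewrite -norm_joinEl; last first.
    by apply: subset_trans MN (sub_abelian_norm abN (Mho_sub _ _)).
  by rewrite join_subG joing_subr andbT sub_gen// subsetU//;
     apply/orP; left; rewrite gen_subG; apply/subsetP => x; rewrite inE => /cM.
have capE : M :&: W :&: Phi = M :&: Phi by rewrite -setIA (setIidPr PhiW).
have mulE : (M :&: W) * Phi = W.
  by rewrite setIC group_modr// (setIidPl WMP).
by have := mul_cardG (M :&: W)%G 'Mho^1(N)%G; rewrite /= capE mulE.
Qed.

Variable NN : nat -> {group gT}.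
Hypothesis NN_mono : forall i j, (i <= j)%N -> NN i \subset NN j.
Hypothesis NN_sub : forall i, NN i \subset N.

Definition staged (c : seq gT) :=
  all (fun i => nth 1 c i \in NN i) (iota 0 (size c)).

Lemma staged_rcons c x : staged (rcons c x) = staged c && (x \in NN (size c)).
Proof.
rewrite /staged size_rcons -addn1 iotaD all_cat /= andbT add0n.
rewrite nth_rcons ltnn eqxx; congr (_ && _); apply: eq_in_all => i.
by rewrite mem_iota /= add0n nth_rcons => ->.
Qed.

Lemma staged_sub c : staged c -> {subset c <= NN (size c)}.
Proof.
move=> /allP h x /(nthP 1)[i ic <-].
apply: (subsetP (NN_mono (ltnW ic))); apply: h.
by rewrite mem_iota.
Qed.

Variable s : nat -> nat.
(** The image of [NN i] in [N / Phi] has dimension [s i]. *)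
Hypothesis sNN : forall i, (#|NN i :&: Phi| * p ^ s i = #|NN i|)%N.

(** Linear independence modulo [Phi], expressed by the span having the largest order that
    [card_frattini_span_le] allows. *)
Definition staged_free (c : seq gT) :=
  staged c && (#|frattini_span c| == p ^ size c * #|Phi|)%N.

Lemma staged_free_rcons c x : staged_free (rcons c x) =
  [&& staged_free c, x \in NN (size c) & x \notin frattini_span c].
Proof.
rewrite /staged_free staged_rcons -!andbA.
have [sc|//] := boolP (staged c); rewrite /= andbCA.
have [xN|//] := boolP (x \in NN _) => /=.
have cN : {subset c <= N} by move=> y /(staged_sub sc); apply/subsetP/NN_sub.
rewrite card_frattini_span_rcons//; last exact: (subsetP (NN_sub _)) xN.
rewrite size_rcons expnS -mulnA; case: ifP => xW /=; last first.
  by rewrite eqn_pmul2l ?prime_gt0// andbT.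
(* For [x] in the span, equality would make the span of [c] exceed its maximal order by a factor
   [p]. *)
rewrite mul1n andbF; apply/eqP => h.
have := card_frattini_span_le cN; rewrite h leqNgt => /negP; apply.
by rewrite ltn_Pmull ?prime_gt1// muln_gt0 expn_gt0 prime_gt0//= cardG_gt0.
Qed.

Variable F : realFieldType.

(** The next entry is any element of [NN i] outside the span of the [i] independent entries before
    it. Whichever these are, their span covers a fraction [p ^ i / p ^ s i] of [NN i], so the count
    is a product. *)
Lemma count_staged_free m :
  (\sum_(c : m.-tuple gT) (staged_free c)%:R =
   \prod_(i < m) (#|NN i|%:R * (1 - p%:R ^+ i / p%:R ^+ s i)) :> F)%R.
Proof.
have p0 : (p%:R != 0 :> F)%R by rewrite pnatr_eq0 -lt0n prime_gt0.
elim: m => [|m IH].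
  rewrite big_ord0 (sum_tuple0 (fun c => (staged_free c)%:R)%R).
  rewrite /staged_free /= mul1n.
  suff -> : frattini_span [::] = Phi :> {set gT} by rewrite eqxx.
  apply/joing_idPr; rewrite gen_subG; apply/subsetP => x.
  by rewrite inE.
rewrite (sum_tuple_rcons _ (fun c => (staged_free c)%:R)%R) big_ord_recr /= -IH mulr_suml.
apply: eq_bigr => c _.
under eq_bigr do rewrite staged_free_rcons size_tuple.
have [/andP[stc /eqP cc]/=|_ /=] := boolP (staged_free c); last first.
  by rewrite mul0r big1.
rewrite mul1r -natr_sum.
have -> : (\sum_x (((x \in NN m) && (x \notin frattini_span c)) : nat) =
   #|NN m :\: frattini_span c|)%N.
  rewrite -sum1_card [RHS]big_mkcond /=; apply: eq_bigr => x _.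
  by rewrite inE andbC; case: ifP.
rewrite cardsD natrB ?subset_leq_card ?subsetIl// mulrBr mulr1; congr (_ - _)%R.
have cN : {subset c <= NN m}.
  by have := staged_sub stc; rewrite size_tuple.
have := card_frattini_span_capl (NN_sub m) cN.
rewrite cc size_tuple mulnAC => /eqP; rewrite eqn_pmul2r ?cardG_gt0// => /eqP ->.
rewrite -(sNN m) !natrM !natrX -mulrA; rewrite mulrC; congr (_ * _)%R.
by rewrite mulrCA mulfV ?mulr1// expf_neq0.
Qed.

(** In a space [N / Phi] of dimension [n], independence of [n] vectors amounts to spanning. *)
Lemma staged_freeE n c : (#|N| = p ^ n * #|Phi|)%N -> size c = n ->
  staged_free c = staged c && (<<[set x in c]>> == N :> {set gT}).
Proof.
move=> cN sc; rewrite /staged_free; case: (boolP (staged c)) => //= stc.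
have cN' : {subset c <= N} by move=> y /(staged_sub stc); apply/subsetP/NN_sub.
by rewrite -frattini_span_full// sc -cN eqEcard frattini_span_sub// eqn_leq
  (subset_leq_card (frattini_span_sub cN')).
Qed.

End FrattiniCount.

(** * Reduction of p-adic integers *)

Definition padic_red (p k : nat) (x : padic_int p) : 'Z_(p ^ k.+1) := x k.

Section PadicReduction.
Context (p : nat) (p_pr : prime p).
Local Notation Zp := (padic_int p).

Fact padic_red_additive k : zmod_morphism (@padic_red p k).
Proof. by []. Qed.
Fact padic_red_multiplicative k : monoid_morphism (@padic_red p k).
Proof. by []. Qed.
HB.instance Definition _ k :=
  GRing.isZmodMorphism.Build Zp ('Z_(p ^ k.+1)) (@padic_red p k)
    (padic_red_additive k).
HB.instance Definition _ k :=
  GRing.isMonoidMorphism.Build Zp ('Z_(p ^ k.+1)) (@padic_red p k)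
    (padic_red_multiplicative k).

Lemma pexp_gt1 k : (1 < p ^ k.+1)%N.
Proof. by rewrite -(expn0 p) ltn_exp2l// prime_gt1. Qed.

Lemma modulus_pexp k : (Zp_trunc (p ^ k.+1)).+2 = (p ^ k.+1)%N.
Proof. by rewrite Zp_cast ?pexp_gt1. Qed.

Lemma padic_lift k (a : 'Z_(p ^ k.+1)) : padic_red k ((a : nat)%:R : Zp) = a.
Proof. by rewrite rmorph_nat natr_Zp. Qed.

Lemma padic_val_le (x : Zp) j k : (j <= k)%N ->
  (x k : nat) = x j %[mod p ^ j.+1].
Proof.
elim: k => [|k IH]; first by rewrite leqn0 => /eqP->.
rewrite leq_eqVlt => /orP[/eqP-> //|jk].
rewrite -(IH jk) -(padic_modP x k) Zp_nat /= (modulus_pexp k) modn_dvdm//.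
by rewrite dvdn_exp2l.
Qed.

Lemma eq_natr_pexp k a b : a = b %[mod p ^ k.+1] ->
  a%:R = b%:R :> 'Z_(p ^ k.+1).
Proof. by move=> ab; apply: eq_natr_Zp; rewrite modulus_pexp. Qed.

Lemma natr_val_natr j m :
  ((m%:R : 'Z_(p ^ j.+2)) : nat)%:R = m%:R :> 'Z_(p ^ j.+1).
Proof.
rewrite [nat_of_ord _](val_Zp_nat (pexp_gt1 _)) natr_modZp//.
by rewrite modulus_pexp dvdn_exp2l.
Qed.

Lemma padic_red_eq0 k (x : Zp) : padic_red k x = 0 ->
  exists y : Zp, x = y *+ p ^ k.+1.
Proof.
move=> xk0; set q := (p ^ k.+1)%N.
have dvdx j : (q %| x (j + k.+1)%N)%N.
  have := @padic_val_le x k (j + k.+1) (leq_trans (leqnSn _) (leq_addl _ _)).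
  by rewrite [x k]xk0 mod0n => /eqP.
(* The residue of index [j + k.+1] is modulo p^(j+k+2); dividing it by p^(k+1) leaves a residue
   modulo p^(j+1). *)
pose y j : 'Z_(p ^ j.+1) := (x (j + k.+1)%N %/ q)%:R.
have yP j : ((y j.+1 : nat)%:R : 'Z_(p ^ j.+1)) = y j.
  rewrite natr_val_natr.
  apply: eq_natr_pexp; apply/eqP.
  have q0 : (0 < q)%N by rewrite expn_gt0 prime_gt0.
  rewrite -(eqn_pmul2r q0) !muln_modl// !divnK// -expnD.
  have -> : (j.+1 + k.+1 = (j + k.+1).+1)%N by rewrite addSn.
  by rewrite padic_val_le.
exists (PadicInt yP); apply: padic_ext => j.
rewrite -[RHS]/(padic_red j _) rmorphMn /= /padic_red /= -mulr_natr -natrM divnK//.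
by rewrite -[LHS]natr_Zp; apply: eq_natr_pexp; rewrite padic_val_le ?leq_addr.
Qed.

(** Every residue of [x] is prime to [p], and the inverses of the residues are compatible because
    inverses are unique. *)
Lemma padic_unit (x : Zp) : padic_red 0 x = 1 -> exists y : Zp, x * y = 1.
Proof.
move=> x1.
have ux j : (x j : 'Z_(p ^ j.+1)) \is a GRing.unit.
  rewrite -[x j]natr_Zp unitZpE ?pexp_gt1// coprimeXl//.
  rewrite prime_coprime// -[p in (p %| _)%N]expn1 /dvdn.
  rewrite (@padic_val_le x 0)// [x 0]x1 /= !modn_small ?prime_gt1 ?modulus_pexp ?expn1 ?prime_gt1//.
pose y j : 'Z_(p ^ j.+1) := (x j)^-1.
have yP j : ((y j.+1 : nat)%:R : 'Z_(p ^ j.+1)) = y j.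
  apply: (mulrI (ux j)); rewrite mulrV ?ux// -(padic_modP x j) -natrM.
  have := congr1 val (mulrV (ux j.+1)) => /= h.
  by rewrite -(natr_modZp _ (Zp_trunc_dvd p j)) h natr_modZp// Zp_trunc_dvd.
by exists (PadicInt yP); apply: padic_ext => j /=; rewrite mulrV ?ux.
Qed.

End PadicReduction.

(** * Relations between elements of a finite abelian group *)

Import FinRing.Theory.

Lemma card_cV_forall (T : finType) n (S : 'I_n -> {set T}) :
  #|[set v : 'cV[T]_n | [forall i, v i 0 \in S i]]| = (\prod_i #|S i|)%N.
Proof.
rewrite -sum1_card.
under [RHS]eq_bigr do rewrite -sum1_card.
rewrite bigA_distr_big_dep /=.
rewrite (reindex (fun g : {ffun 'I_n -> T} => \col_i g i)) /=; last first.
  exists (fun v : 'cV[T]_n => [ffun i => v i 0]) => g _.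
    by apply/ffunP => i; rewrite ffunE mxE.
  by apply/matrixP => i j; rewrite mxE ffunE ord1.
rewrite [RHS](eq_bigr (fun=> 1%N)) => [|g _]; last by rewrite big1.
apply: eq_bigl => g; rewrite inE; apply/forallP/familyP => h i;
  by have := h i; rewrite ?mxE.
Qed.

Section LinearCombination.
Context (p k : nat) (p_pr : prime p) (H : finZmodType).
Hypothesis Hk : forall x : H, x *+ p ^ k = 0.
Local Notation q := (p ^ k.+1)%N.
Local Notation Zq := ('Z_(p ^ k.+1)).

Lemma mulrn_modq (x : H) m : x *+ (m %% q) = x *+ m.
Proof.
rewrite {2}(divn_eq m q) mulrnDr [(_ * q)%N]mulnC expnSr -!mulnA mulrnA Hk.
by rewrite mul0rn add0r.
Qed.

Lemma mulrn_ZqD (x : H) (a b : Zq) :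
  x *+ (a + b)%R = x *+ (a : nat) + x *+ (b : nat).
Proof. by rewrite -mulrnDr -[RHS]mulrn_modq /= {3}modulus_pexp. Qed.

(** Scalars act through their natural representatives, which is additive in the scalar because
    [p ^ k] kills [H]. *)
Definition lincomb n (f : seq H) (v : 'cV[Zq]_n) : H :=
  \sum_(i < n) nth 0 f i *+ (v i 0 : nat).

Variable n : nat.
Local Notation V := ('cV[Zq]_n).
Implicit Types (f : seq H) (v : V).

Lemma lincombD f v w : lincomb f (v + w) = lincomb f v + lincomb f w.
Proof.
rewrite /lincomb -big_split /=; apply: eq_bigr => i _.
by rewrite mxE mulrn_ZqD.
Qed.

Lemma lincomb0 f : lincomb f (0 : V) = 0.
Proof. by rewrite /lincomb big1 // => i _; rewrite mxE. Qed.

Lemma lincombN f v : lincomb f (- v) = - lincomb f v.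
Proof. by apply/eqP; rewrite -addr_eq0 -lincombD addNr lincomb0. Qed.

Lemma lincombB f v w : lincomb f (v - w) = lincomb f v - lincomb f w.
Proof. by rewrite lincombD lincombN. Qed.

Lemma lincomb_delta f (i : 'I_n) : lincomb f (delta_mx i 0) = nth 0 f i.
Proof.
rewrite /lincomb (bigD1 i) //= big1 => [|j ji]; last first.
  by rewrite mxE (negbTE ji).
rewrite mxE !eqxx addr0 -[RHS]mulr1n; congr (_ *+ _).
Qed.

(** The entries of such a [v] are multiples of [p ^ k], which kills [H]. This is the gain from
    working modulo p^(k+1) instead of p^k: relations contain all the [p]-torsion, so their rank does
    not depend on [f]. *)
Lemma lincomb_torsion f v : v *+ p = 0 -> lincomb f v = 0.
Proof.
move=> pv; rewrite /lincomb big1// => i _.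
have : (q %| (v i 0%R : nat) * p)%N.
  have /(congr1 (fun w : V => w i 0)) := pv; rewrite mulmxnE mxE.
  rewrite -{1}[v i 0]natr_Zp -mulrnA => /(congr1 (@nat_of_ord _)).
  by rewrite val_Zp_nat ?pexp_gt1//= => /eqP.
move: (v i 0 : nat) => a; rewrite expnSr dvdn_pmul2r ?prime_gt0//.
by move=> /dvdnP[c ->]; rewrite mulnC mulrnA Hk mul0rn.
Qed.

Definition initial_coords (s : nat) : {set V} :=
  [set v : V | [forall i : 'I_n, (s <= i)%N ==> (v i 0 == 0)]].

Lemma initial_coordsP s v :
  reflect (forall i : 'I_n, (s <= i)%N -> v i 0 = 0) (v \in initial_coords s).
Proof.
rewrite inE; apply: (iffP forallP) => h i; first by move/(implyP (h i))/eqP.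
by apply/implyP => /h ->.
Qed.

(** The admissible values of a column of height [s] once the presentation [f] is fixed. *)
Definition relations f s : {set V} := [set v in initial_coords s | lincomb f v == 0].

Fact initial_coords_group_set s : group_set (initial_coords s).
Proof.
apply/group_setP; split; first by apply/initial_coordsP => i _; rewrite mxE.
move=> v w /initial_coordsP hv /initial_coordsP hw; apply/initial_coordsP => i si.
by rewrite mxE hv// hw// addr0.
Qed.
Canonical initial_coords_group s := Group (initial_coords_group_set s).

Fact relations_group_set f s : group_set (relations f s).
Proof.
apply/group_setP; split; first by rewrite inE group1 /= zmod1gE lincomb0.
move=> v w; rewrite !inE => /andP[hv /eqP fv] /andP[hw /eqP fw].
rewrite zmodMgE lincombD fv fw addr0 eqxx andbT.
by have := @groupM _ (initial_coords_group s) v w; rewrite /= !inE => ->.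
Qed.
Canonical relations_group f s := Group (relations_group_set f s).

Lemma cV_Zq_pgroup (G : {group V}) : (p.-group G)%g.
Proof.
apply/pgroupP => l l_pr /Cauchy [//|v vG ov].
have : (#[v]%g %| q)%N.
  rewrite order_dvdn zmodXgE; apply/eqP/matrixP => i j.
  by rewrite mulmxnE mxE -mulr_natr pchar_Zp ?pexp_gt1 ?mulr0.
by rewrite ov Euclid_dvdX// => /andP[+ _]; rewrite dvdn_prime2.
Qed.

Lemma cV_Zq_abelian (G : {group V}) : abelian G.
Proof. by apply/centsP => v _ w _; rewrite /commute !zmodMgE addrC. Qed.

Lemma card_initial_coords s : (s <= n)%N -> #|initial_coords s| = (q ^ s)%N.
Proof.
move=> sn; pose S (i : 'I_n) : {set Zq} := if (i < s)%N then [set: Zq] else [set 0].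
have -> : initial_coords s = [set v : V | [forall i, v i 0 \in S i]].
  apply/setP => v; rewrite !inE; apply: eq_forallb => i; rewrite /S.
  by case: ltnP => _; rewrite ?inE.
rewrite card_cV_forall (bigID (fun i : 'I_n => (i < s)%N)) /=.
rewrite [X in (_ * X)%N]big1 => [|i /negbTE h]; last by rewrite /S h cards1.
rewrite muln1 (eq_bigr (fun=> q)) => [|i h]; last first.
  by rewrite /S h cardsT card_ord modulus_pexp.
by rewrite -(big_ord_widen _ (fun=> q))// prod_nat_const card_ord.
Qed.

Lemma card_torsion_Zq : #|[set a : Zq | a *+ p == 0]| = p.
Proof.
have cyc : cyclic [set: Zq]%G by apply/cyclicP; exists Zp1; apply: Zp_cycle.
have pZ : (p.-group [set: Zq]%G)%g.
  by rewrite /pgroup cardsT card_ord modulus_pexp// pnatX pnat_id.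
have := Ohm1_cyclic_pgroup_prime cyc pZ; rewrite -cardG_gt1 cardsT card_ord.
move=> /(_ isT) /=.
rewrite (OhmEabelian pZ) ?(abelianS (Ohm_sub _ _))// ?(cyclic_abelian cyc)//.
move=> cardO; rewrite -[RHS]cardO; apply: eq_card => a; rewrite !inE expn1.
by rewrite zmodXgE.
Qed.

(** By [lincomb_torsion], the [p]-torsion here is that of the whole free module on [s]
    coordinates. *)
Lemma card_Ohm_relations f s : (s <= n)%N -> #|'Ohm_1(relations f s)%g| = (p ^ s)%N.
Proof.
move=> sn; rewrite (OhmEabelian (cV_Zq_pgroup _)) ?cV_Zq_abelian//.
pose S (i : 'I_n) : {set Zq} :=
  if (i < s)%N then [set a : Zq | a *+ p == 0] else [set 0].
have -> : ('Ldiv_(p ^ 1)(relations f s))%g = [set v : V | [forall i, v i 0 \in S i]].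
  apply/setP => v; rewrite expn1 [in RHS]inE in_setI.
  rewrite [v \in 'Ldiv_p()%g]inE zmodXgE [v \in relations _ _]inE.
  apply/andP/forallP => [[/andP[/initial_coordsP vs _] /eqP vp] i|h].
    rewrite /S; case: ltnP => si; rewrite inE; last by rewrite vs.
    by rewrite -mulmxnE vp mxE.
  have vp : v *+ p = 0.
    apply/matrixP => i j; rewrite mulmxnE mxE ord1; have := h i; rewrite /S.
    by case: ifP => _; rewrite inE => /eqP // ->; rewrite mul0rn.
  rewrite vp lincomb_torsion// !eqxx; split=> //; rewrite andbT.
  apply/initial_coordsP => i si; have := h i.
  by rewrite /S ltnNge si /= inE => /eqP.
rewrite card_cV_forall (bigID (fun i : 'I_n => (i < s)%N)) /=.
rewrite [X in (_ * X)%N]big1 => [|i /negbTE h]; last by rewrite /S h cards1.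
rewrite muln1 (eq_bigr (fun=> p)) => [|i h]; last by rewrite /S h card_torsion_Zq.
by rewrite -(big_ord_widen _ (fun=> p))// prod_nat_const card_ord.
Qed.

(** This makes the dimension of [relations f s] modulo the Frattini subgroup of the full group of
    relations equal to its own rank [s]. *)
Lemma relations_cap_Mho f s : (s <= n)%N ->
  (relations f s :&: 'Mho^1(relations f n) = 'Mho^1(relations f s))%g.
Proof.
move=> sn; rewrite !(MhoEabelian _ (cV_Zq_pgroup _) (cV_Zq_abelian _)) expn1.
apply/setP => v; apply/idP/imsetP; last first.
  case=> w wR ->; rewrite inE groupX//=; apply/imsetP; exists w => //.
  by move: wR; rewrite !inE => /andP[_ ->]; rewrite andbT;
     apply/forallP => i; apply/implyP; rewrite leqNgt ltn_ord.
rewrite inE => /andP[vR /imsetP[w wR vw]].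
have vs : forall i : 'I_n, (s <= i)%N -> v i 0 = 0.
  by apply/initial_coordsP; move: vR; rewrite inE => /andP[].
(* Truncating [w] changes it only by [p]-torsion, since [v], its multiple by [p], vanishes beyond
   [s]; the truncation is thus still a relation. *)
pose w' : V := \col_i if (i < s)%N then w i 0 else 0.
have pw' : (w - w') *+ p = 0.
  rewrite mulrnBl -zmodXgE -vw; apply/matrixP => i j; rewrite ord1 !mxE mulmxnE mxE.
  case: ltnP => si; last by rewrite vs// mul0rn subr0.
  by rewrite vw zmodXgE mulmxnE subrr.
exists w'; last first.
  by rewrite vw !zmodXgE; apply/eqP; rewrite -subr_eq0 -mulrnBl pw'.
rewrite inE; apply/andP; split.
  by apply/initial_coordsP => i si; rewrite mxE ltnNge si.
move: wR; rewrite inE => /andP[_ /eqP fw].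
have := lincomb_torsion f pw'; rewrite lincombB fw sub0r => /eqP.
by rewrite oppr_eq0.
Qed.

Lemma lincomb_initial_coords f s : size f = n ->
  [set lincomb f v | v in initial_coords s] = <<[set x in take s f]>>%g.
Proof.
move=> fn; apply/eqP; rewrite eqEsubset; apply/andP; split.
  apply/subsetP => _ /imsetP[v /initial_coordsP vs ->].
  rewrite /lincomb; elim/big_rec: _ => [|i x _ xG].
    exact: (group1 <<[set x in take s f]>>%G).
  apply: (@groupM _ <<[set x in take s f]>>%G) xG.
  rewrite -zmodXgE; case: (leqP s i) => [/vs ->|si]; first exact: group1.
  apply/groupX/mem_gen; rewrite inE -(nth_take 0 si) mem_nth//.
  by rewrite size_take_min fn leq_min si ltn_ord.
have mD : {in [set: V] &, {morph @lincomb n f : v w / (v * w)%g >-> (v * w)%g}}.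
  by move=> v w _ _; rewrite /= lincombD.
pose g : {morphism [set: V]%G >-> H} := Morphism mD.
have -> : [set lincomb f v | v in initial_coords s] =
          @morphim _ _ _ g (MorPhantom g) (initial_coords s).
  by rewrite morphimEsub ?subsetT.
rewrite gen_subG; apply/subsetP => x xs.
have /(nthP 0)[i] : x \in take s f by move: xs; rewrite inE.
rewrite size_take_min fn leq_min => /andP[si ni] <-.
rewrite /= morphimEsub ?subsetT//; apply/imsetP; exists (delta_mx (Ordinal ni) 0).
  apply/initial_coordsP => j sj; rewrite mxE; case: eqP => // ji.
  by move: sj; rewrite ji /= leqNgt si.
by rewrite /= lincomb_delta nth_take.
Qed.

Lemma card_relations f s : size f = n -> (s <= n)%N ->
  (#|relations f s| * #|<<[set x in take s f]>>%g| = q ^ s)%N.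
Proof.
move=> fn sn; rewrite -lincomb_initial_coords//.
have mD : {in initial_coords s &, {morph @lincomb n f : v w / (v * w)%g >-> (v * w)%g}}.
  by move=> v w _ _; rewrite /= lincombD.
pose g : {morphism initial_coords s >-> H} := Morphism mD.
have -> : [set lincomb f v | v in initial_coords s] =
          @morphim _ _ _ g (MorPhantom g) (initial_coords s).
  by rewrite morphimEsub.
have -> : relations f s = ('ker g)%g.
  by apply/setP => v; rewrite !inE; congr (_ && _).
by rewrite card_morphim /= setIid Lagrange ?subsetIl// card_initial_coords.
Qed.

Definition cols (A : 'M[Zq]_n) : n.-tuple V := [tuple col j A | j < n].

Lemma cols_bij : bijective cols.
Proof.
exists (fun c => \matrix_(i, j) (tnth c j : V) i 0) => [A|c].
  by apply/matrixP => i j; rewrite mxE tnth_mktuple mxE.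
apply: eq_from_tnth => j; rewrite tnth_mktuple; apply/matrixP => i l.
by rewrite !mxE ord1.
Qed.

(** Residues are images of natural numbers, so linear combinations are sums of multiples in the
    group. *)
Lemma gen_cols A : <<[set x in cols A]>>%g = [set A *m u | u : V].
Proof.
have gs : group_set [set A *m u | u : V].
  apply/group_setP; split.
    by apply/imsetP; exists 0; rewrite ?mulmx0.
  move=> _ _ /imsetP[u _ ->] /imsetP[w _ ->]; apply/imsetP; exists (u + w) => //.
  by rewrite zmodMgE mulmxDr.
apply/eqP; rewrite eqEsubset; apply/andP; split.
  rewrite (gen_subG _ (Group gs)); apply/subsetP => x xc.
  have /tnthP[j ->] : x \in cols A by move: xc; rewrite inE.
  by rewrite tnth_mktuple colE imset_f.
apply/subsetP => _ /imsetP[u _ ->].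
have -> : A *m u = \sum_(j < n) col j A *+ (u j 0 : nat).
  apply/matrixP => i l; rewrite mxE summxE; apply: eq_bigr => j _.
  by rewrite mulmxnE mxE ord1 -mulr_natr natr_Zp.
elim/big_rec: _ => [|j x _ xG].
  exact: (group1 <<[set x in cols A]>>%G).
apply: (@groupM _ <<[set x in cols A]>>%G) xG.
rewrite -zmodXgE; apply/groupX/mem_gen; rewrite inE; apply/tnthP; exists j.
by rewrite tnth_mktuple.
Qed.

Lemma relationsT f v : (v \in relations f n) = (lincomb f v == 0).
Proof.
rewrite inE andb_idl// => _; apply/initial_coordsP => i.
by rewrite leqNgt ltn_ord.
Qed.

Lemma relations_mono f s s' : (s <= s')%N -> relations f s \subset relations f s'.
Proof.
move=> ss; apply/subsetP => v; rewrite 2!inE => /andP[/forallP h fv].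
rewrite inE fv andbT; apply/initial_coordsP => i si.
by apply/eqP; apply: implyP (h i) (leq_trans ss si).
Qed.

Lemma count_spanning_matrices (F : realFieldType) (s : nat -> nat) f :
  size f = n -> (forall i, s i <= n)%N ->
  (forall i j, i <= j -> s i <= s j)%N ->
  \sum_(A : 'M[Zq]_n) ([forall j : 'I_n, col j A \in initial_coords (s j)] &&
      ([set A *m u | u : V] == relations f n))%:R =
  \prod_(j < n) ((q ^ s j)%:R / #|<<[set x in take (s j) f]>>%g|%:R *
     (1 - p%:R ^+ j / p%:R ^+ s j)) :> F.
Proof.
move=> fn sn smono.
pose NN i := relations_group f (s i).
have NNmono i j : (i <= j)%N -> NN i \subset NN j.
  by move=> ij; apply/relations_mono/smono.
have NNsub i : NN i \subset relations_group f n by apply: relations_mono.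
(* In an abelian group, the orders of the [p]-torsion and of the subgroup of [p]-multiples multiply
   to the order of the group. *)
have cardE m : (m <= n)%N ->
    #|relations f m| = (#|'Mho^1(relations f m)%g| * p ^ m)%N.
  move=> mn; rewrite -(card_Ohm_relations f mn) mulnC.
  by rewrite (mul_card_Ohm_Mho_abelian 1 (cV_Zq_abelian (relations_group f m))).
have sNN i : (#|(NN i :&: 'Mho^1(relations f n))%g| * p ^ s i = #|NN i|)%N.
  by rewrite relations_cap_Mho// -cardE.
have cardN : #|relations_group f n| = (p ^ n * #|'Mho^1(relations f n)%g|)%N.
  by rewrite mulnC -cardE.
have abN := cV_Zq_abelian (relations_group f n).
have pN := cV_Zq_pgroup (relations_group f n).
transitivity (\sum_(c : n.-tuple V)
    (staged_free p (relations_group f n) NN c)%:R : F); last first.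
  rewrite (count_staged_free p_pr abN pN NNmono NNsub sNN).
  apply: eq_bigr => j _; congr (_ * _).
  rewrite -(card_relations fn (sn j)) natrM mulfK//.
  by rewrite pnatr_eq0 -lt0n cardG_gt0.
rewrite (reindex cols); last by apply/onW_bij/cols_bij.
apply: eq_bigr => A _; congr (nat_of_bool _)%:R.
rewrite (staged_freeE abN pN NNmono NNsub cardN (size_tuple _)) gen_cols.
have [e|_] := eqVneq [set A *m u | u : V]; last by rewrite !andbF.
rewrite !andbT /staged size_tuple.
(* The column span being the group of relations, each column is a relation and only its support is
   left to compare. *)
apply/forallP/allP => h.
  move=> i; rewrite mem_iota /= add0n => ni.
  have -> : nth 1%g (cols A) i = col (Ordinal ni) A.
    by rewrite -[i]/(nat_of_ord (Ordinal ni)) -tnth_nth tnth_mktuple.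
  rewrite inE (h (Ordinal ni)) /=.
  by rewrite -relationsT -e colE imset_f.
move=> j; have := h j; rewrite mem_iota ltn_ord => /(_ isT).
by rewrite -tnth_nth tnth_mktuple inE => /andP[].
Qed.

Lemma lincomb_surj (f : n.-tuple H) : <<[set x in f]>>%g = [set: H] ->
  forall x, exists v : V, lincomb f v = x.
Proof.
move=> gf x; have := lincomb_initial_coords n (size_tuple f).
rewrite take_oversize ?size_tuple// gf => /setP /(_ x); rewrite inE.
by move=> /imsetP[v _ ->]; exists v.
Qed.

Lemma lincomb_map (g : H -> H) (f : n.-tuple H) v : {morph g : x y / x + y} ->
  lincomb (map g f) v = g (lincomb f v).
Proof.
move=> gD; have g0 : g 0 = 0 by apply: (addrI (g 0)); rewrite -gD !addr0.
have gM x m : g (x *+ m) = g x *+ m.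
  by elim: m => [|m IH]; rewrite ?mulr0n// !mulrS gD IH.
rewrite /lincomb (big_morph g gD g0); apply: eq_bigr => i _.
by rewrite gM (nth_map 0)// size_tuple.
Qed.

(** * Automorphisms acting on presentations *)

Lemma AutT_morph (a : {perm H}) :
  (a \in Aut [set: H]) = [forall x, forall y, a (x + y) == a x + a y].
Proof.
apply/idP/forallP => [/Aut_morphic /morphicP h x|h].
  by apply/forallP => y; rewrite -[_ + y]/(x * y)%g h ?inE.
rewrite inE; apply/andP; split; first by apply/subsetP => x; rewrite inE.
apply/morphicP => x y _ _; exact/eqP/(forallP (h x)).
Qed.

(** Two surjections with the same kernel differ by a unique automorphism of the target, so the
    presentations with the relations of [f0] form a free orbit of the automorphism group. *)
Lemma card_presentations (f0 : n.-tuple H) : <<[set x in f0]>>%g = [set: H] ->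
  #|[set f : n.-tuple H | (<<[set x in f]>>%g == [set: H]) &&
      (relations f n == relations f0 n)]| = #|Aut [set: H]|.
Proof.
move=> gf0.
rewrite -[RHS](@card_in_imset _ _ (fun a : {perm H} => map_tuple a f0)); last first.
  move=> a b; rewrite !AutT_morph => ha hb ab; apply/permP => x.
  have [v <-] := lincomb_surj gf0 x.
  have mor c : [forall x, forall y, (c : {perm H}) (x + y) == c x + c y] ->
    {morph c : x y / x + y} by move=> /forallP h y z; apply/eqP/(forallP (h y)).
  rewrite -!lincomb_map; try exact: mor.
  by rewrite [map a f0](congr1 val ab).
apply: eq_card => f; rewrite inE; apply/andP/imsetP; last first.
  case=> a aA ->.
  have aD : {morph a : x y / x + y}.
    by move=> x y; move: aA; rewrite AutT_morph => /forallP/(_ x)/forallP/(_ y)/eqP.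
  split; last first.
    apply/eqP/setP => v; rewrite !relationsT lincomb_map//.
    have a0 : a 0 = 0 by apply: (addrI (a 0)); rewrite -aD !addr0.
    by rewrite -{1}a0 (inj_eq perm_inj).
  apply/eqP/setP => x; rewrite inE.
  have := lincomb_initial_coords n (size_tuple (map_tuple a f0)).
  rewrite take_oversize ?size_tuple// => <-.
  have [v vE] := lincomb_surj gf0 ((a^-1)%g x).
  apply/imsetP; exists v; last by rewrite lincomb_map// vE permKV.
  by apply/initial_coordsP => i; rewrite leqNgt ltn_ord.
case=> /eqP gf /eqP rff.
have kerE (v w : V) : (lincomb f0 v == lincomb f0 w) = (lincomb f v == lincomb f w).
  have eqE (f' : seq H) : (lincomb f' v == lincomb f' w) = (v - w \in relations f' n).
    by rewrite relationsT lincombB subr_eq0.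
  by rewrite !eqE rff.
have surj x : exists v : V, lincomb f0 v == x.
  by have [v <-] := lincomb_surj gf0 x; exists v.
(* The automorphism maps [x] through any preimage under [f0]; equality of the kernels makes the
   choice irrelevant, which is [gE]. *)
pose g x := lincomb f (xchoose (surj x)).
have gE v : g (lincomb f0 v) = lincomb f v.
  by apply/eqP; rewrite -kerE (xchooseP (surj _)).
have g_inj : injective g.
  move=> x y; have [v <-] := lincomb_surj gf0 x; have [w <-] := lincomb_surj gf0 y.
  by rewrite !gE => /eqP; rewrite -kerE => /eqP.
exists (perm g_inj).
  rewrite AutT_morph; apply/forallP => x; apply/forallP => y; rewrite !permE.
  have [v <-] := lincomb_surj gf0 x; have [w <-] := lincomb_surj gf0 y.
  by rewrite -lincombD !gE lincombD.
apply: eq_from_tnth => i; rewrite tnth_map permE.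
by rewrite !(tnth_nth 0) -!(@lincomb_delta _ i) gE.
Qed.

End LinearCombination.

(** * Recursion on the rows *)

Section GeneratedSum.
Context (F : realFieldType) (H : finGroupType).
Local Notation h := #|H|.
Implicit Types (f : seq H) (x : H).

Definition ngen (f : seq H) : nat := #|<<[set x in f]>>%g|.

Lemma ngen_gt0 f : (0 < ngen f)%N. Proof. exact: cardG_gt0. Qed.

Lemma ngenR_gt0 f : 0 < (ngen f)%:R :> F.
Proof. by rewrite ltr0n ngen_gt0. Qed.

Definition generates (f : seq H) := <<[set x in f]>>%g == [set: H].

Lemma gen_rcons f x :
  <<[set y in rcons f x]>>%g = (<<[set y in f]>> <*> <[x]>)%g.
Proof.
rewrite joing_idl joing_idr; congr <<_>>%g.
by apply/setP => y; rewrite !inE mem_rcons inE orbC.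
Qed.

Lemma generates_rcons f x : generates f -> generates (rcons f x).
Proof.
move=> /eqP gf; rewrite /generates gen_rcons gf eqEsubset subsetT /=.
exact: joing_subl.
Qed.

Lemma ngen_generates f : generates f -> ngen f = h.
Proof. by move=> /eqP gf; rewrite /ngen gf cardsT. Qed.

Lemma ngen_rcons_in f x : x \in <<[set y in f]>>%g -> ngen (rcons f x) = ngen f.
Proof.
move=> xf; rewrite /ngen gen_rcons; congr #|(_ : {set _})|.
by apply/joing_idPl; rewrite cycle_subG.
Qed.

Lemma ngen_rcons_notin f x : x \notin <<[set y in f]>>%g ->
  (2 * ngen f <= ngen (rcons f x))%N.
Proof.
move=> xf; rewrite /ngen gen_rcons.
pose A := <<[set y in f]>>%G; pose B := (A <*> <[x]>)%G.
have sAB : A \subset B by apply: joing_subl.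
have <- := Lagrange sAB; rewrite /= mulnC leq_mul2l; apply/orP; right.
rewrite indexg_gt1; apply: contra xf => BA.
by apply: (subsetP BA); apply: (subsetP (joing_subr _ _)); apply: cycle_id.
Qed.

(* An element outside the span of [f] at least doubles it, whence [2 ^- e]. *)
Lemma sum_ngen_rcons_le f e :
  \sum_x (ngen (rcons f x))%:R ^- e <=
    (ngen f)%:R * (ngen f)%:R ^- e * (1 + h%:R * 2 ^- e) :> F.
Proof.
have g0 := ngenR_gt0 f; have ge0 : 0 < (ngen f)%:R ^- e :> F by rewrite invr_gt0 exprn_gt0.
have g1 : 1 <= (ngen f)%:R :> F by rewrite ler1n ngen_gt0.
rewrite (bigID (fun x => x \in <<[set y in f]>>%g)) /=.
rewrite (eq_bigr (fun=> (ngen f)%:R ^- e)) => [|x xf]; last by rewrite ngen_rcons_in.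
rewrite sumr_const -/(ngen f) -[_ *+ _]mulr_natl mulrDr mulr1 lerD2l.
apply: (@le_trans _ _ (\sum_(x : H) (ngen f)%:R ^- e * 2 ^- e)).
  rewrite [leRHS](bigID (fun x => x \in <<[set y in f]>>%g)) /=.
  apply: ler_wpDl; first by apply: sumr_ge0 => x _; rewrite mulr_ge0 ?invr_ge0 ?exprn_ge0 ?ler0n.
  apply: ler_sum => x xf; rewrite -invfM -exprMn lef_pV2 ?posrE ?exprn_gt0 ?mulr_gt0 ?ltr0n ?ngen_gt0//.
  rewrite lerXn2r ?nnegrE ?mulr_ge0 ?ler0n// -natrM ler_nat mulnC.
  exact: ngen_rcons_notin.
rewrite sumr_const -[_ *+ _]mulr_natl.
(* The extra factor [ngen f], at least 1, lets the error share the main term as a common factor. *)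
rewrite [leRHS](_ : _ = (ngen f)%:R * (h%:R * ((ngen f)%:R ^- e * 2 ^- e))); last by ring.
by rewrite ler_peMl// !mulr_ge0 ?invr_ge0 ?exprn_ge0 ?ler0n.
Qed.

Section Staircase.
Variables (d t : nat).
Hypothesis d_ge2 : (2 <= d)%N.
Let d_gt0 : (0 < d)%N := ltnW d_ge2.

(* The exponent [e] is meant to decrease by [d - 1] when [k] increases by 1, which
   keeps the total weight nearly constant. *)
Definition stair_weight (k e : nat) (f : seq H) : F :=
  \prod_(i < k) (ngen (take (t + i) f))%:R ^- d * (ngen f)%:R ^- e.

Lemma stair_weight_ge0 k e f : 0 <= stair_weight k e f.
Proof.
by rewrite mulr_ge0 ?prodr_ge0// => *; rewrite invr_ge0 exprn_ge0.
Qed.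

Lemma stair_weight_rcons k e f x : size f = (t + k)%N ->
  stair_weight k.+1 e (rcons f x) =
  \prod_(i < k) (ngen (take (t + i) f))%:R ^- d * (ngen f)%:R ^- d *
    (ngen (rcons f x))%:R ^- e.
Proof.
move=> sf; rewrite /stair_weight big_ord_recr /= -sf -cats1 take_cat ltnn subnn.
rewrite take0 cats0 cats1; congr (_ * _ * _); apply: eq_bigr => i _.
by rewrite -cats1 takel_cat// sf leq_add2l ltnW.
Qed.

Definition total_weight k e : F :=
  \sum_(f : (t + k).-tuple H) stair_weight k e f.
Definition gen_weight k e : F :=
  \sum_(f : (t + k).-tuple H) stair_weight k e f * (generates f)%:R.

(** The [d] columns of a step give the power [d], and the choices of a new element inside the span
    give back one factor: the exponent grows by [d - 1]. *)
Lemma weight_expE f e : (ngen f)%:R ^- d * ((ngen f)%:R * (ngen f)%:R ^- e) =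
  (ngen f)%:R ^- (e + d.-1) :> F.
Proof.
have g0 : (ngen f)%:R != 0 :> F by rewrite gt_eqF ?ngenR_gt0.
rewrite exprD invfM -{1}(prednK d_gt0) exprS invfM; field.
by rewrite ?expf_neq0 ?g0.
Qed.

Lemma sum_stair_weight_rcons k e f : size f = (t + k)%N ->
  \sum_x stair_weight k.+1 e (rcons f x) <=
  stair_weight k (e + d.-1) f * (1 + h%:R * 2 ^- e).
Proof.
move=> sf; under eq_bigr do rewrite stair_weight_rcons//.
rewrite -mulr_sumr /stair_weight -weight_expE -!mulrA ler_wpM2l//.
  by rewrite prodr_ge0// => *; rewrite invr_ge0 exprn_ge0.
rewrite ler_wpM2l ?invr_ge0 ?exprn_ge0// mulrA.
exact: sum_ngen_rcons_le.
Qed.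

Lemma total_weight_step k e :
  total_weight k.+1 e <= total_weight k (e + d.-1) * (1 + h%:R * 2 ^- e).
Proof.
rewrite /total_weight mulr_suml addnS (sum_tuple_rcons _ (stair_weight k.+1 e)).
by apply: ler_sum => f _; rewrite sum_stair_weight_rcons ?size_tuple.
Qed.

(** All extensions of a generating tuple generate, and their weights add up exactly to its
    weight. *)
Lemma gen_weight_step_ge k e : gen_weight k (e + d.-1) <= gen_weight k.+1 e.
Proof.
rewrite /gen_weight addnS.
rewrite (sum_tuple_rcons _ (fun f => stair_weight k.+1 e f * (generates f)%:R)).
apply: ler_sum => f _.
have [gf|_] := boolP (generates f); last first.
  by rewrite mulr0 sumr_ge0// => x _; rewrite mulr_ge0 ?stair_weight_ge0.
rewrite mulr1 (eq_bigr (fun=> stair_weight k.+1 e (rcons f 1%g))) => [|x _]; last first.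
  rewrite generates_rcons// mulr1 !stair_weight_rcons ?size_tuple//.
  by rewrite !ngen_generates ?generates_rcons.
rewrite sumr_const stair_weight_rcons ?size_tuple// /stair_weight -weight_expE.
rewrite (ngen_generates (generates_rcons 1%g gf)) -[leRHS]mulr_natl (ngen_generates gf).
by rewrite le_eqVlt; apply/orP; left; apply/eqP; ring.
Qed.

(** A tuple that does not generate can do so after one more element only if that element is outside
    its span, and such extensions weigh at most the error term. *)
Lemma gen_weight_step_le k e : gen_weight k.+1 e <=
  gen_weight k (e + d.-1) + total_weight k (e + d.-1) * (h%:R * 2 ^- e).
Proof.
rewrite /gen_weight /total_weight addnS.
rewrite (sum_tuple_rcons _ (fun f => stair_weight k.+1 e f * (generates f)%:R)).
rewrite mulr_suml -big_split /=; apply: ler_sum => f _.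
have [gf|gf] := boolP (generates f).
  rewrite mulr1 -[X in _ <= X + _]mulr1 -mulrDr.
  apply: le_trans (sum_stair_weight_rcons _ (size_tuple f)).
  by apply: ler_sum => x _; rewrite ler_piMr ?stair_weight_ge0// lern1 leq_b1.
rewrite mulr0 add0r.
have g1 : 1 <= (ngen f)%:R :> F by rewrite ler1n ngen_gt0.
have := sum_stair_weight_rcons e (size_tuple f).
set a := \prod_(i < k) (ngen (take (t + i) f))%:R ^- d : F.
have a0 : 0 <= a by rewrite prodr_ge0// => *; rewrite invr_ge0 exprn_ge0.
(* Extensions inside the span make up exactly the main term; cancelling it bounds those outside by
   the error. *)
have -> : \sum_x stair_weight k.+1 e (rcons f x) =
    stair_weight k (e + d.-1) f +
    \sum_(x | x \notin <<[set y in f]>>%g) stair_weight k.+1 e (rcons f x).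
  rewrite (bigID (fun x => x \in <<[set y in f]>>%g)) /=; congr (_ + _).
  rewrite (eq_bigr (fun=> a * (ngen f)%:R ^- d * (ngen f)%:R ^- e)) => [|x xf]; last first.
    by rewrite stair_weight_rcons ?size_tuple// ngen_rcons_in.
  rewrite sumr_const -/(ngen f) /stair_weight -/a -weight_expE -[_ *+ _]mulr_natl; ring.
rewrite mulrDr mulr1 lerD2l; apply: le_trans.
rewrite [leRHS]big_mkcond; apply: ler_sum => x _.
case: ifPn => [_|]; first by rewrite ler_piMr ?stair_weight_ge0// lern1 leq_b1.
rewrite negbK => xf.
suff -> : generates (rcons f x) = false by rewrite mulr0.
apply/negbTE; apply: contra gf; rewrite /generates gen_rcons.
by rewrite (joing_idPl _) ?cycle_subG.
Qed.

Lemma sum_tuple_all m (G : {group H}) :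
  \sum_(f : m.-tuple H) (all (mem G) f)%:R = #|G|%:R ^+ m :> F.
Proof.
elim: m => [|m IH]; first by rewrite (sum_tuple0 (fun f => (all (mem G) f)%:R)).
rewrite (sum_tuple_rcons _ (fun f => (all (mem G) f)%:R)) exprSr -IH mulr_suml.
apply: eq_bigr => f _; under eq_bigr do rewrite all_rcons andbC -mulnb natrM.
rewrite -mulr_sumr; congr (_ * _); rewrite -natr_sum -sum1_card [in RHS]big_mkcond.
by congr (_%:R); apply: eq_bigr => x _; rewrite /=; case: ifP.
Qed.

Lemma sum_tuple_gen_le m (G : {group H}) :
  \sum_(f : m.-tuple H) (<<[set x in f]>>%G == G)%:R <= #|G|%:R ^+ m :> F.
Proof.
rewrite -sum_tuple_all; apply: ler_sum => f _; rewrite ler_nat.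
case: eqP => // fG; suff -> : all (mem G) f by [].
by apply/allP => x xf; rewrite /= -fG; apply: mem_gen; rewrite inE.
Qed.

Lemma sum_group_split f (a : F) :
  a = \sum_(G : {group H}) a * (<<[set x in f]>>%G == G)%:R.
Proof.
rewrite (bigD1 <<[set x in f]>>%G) //= eqxx mulr1 big1 ?addr0 // => G.
by rewrite eq_sym => /negbTE ->; rewrite mulr0.
Qed.

Lemma stair_weight0 e f : stair_weight 0 e f = (ngen f)%:R ^- e.
Proof. by rewrite /stair_weight big_ord0 mul1r. Qed.

(** Sort tuples by the subgroup [G] they generate: at most [#|G| ^ t] tuples, each of weight
    [#|G| ^- t]. *)
Lemma total_weight0_le : total_weight 0 t <= #|{: {group H}}|%:R.
Proof.
rewrite /total_weight addn0 -sumr_const.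
under eq_bigr => f _ do rewrite stair_weight0 (sum_group_split f (_ ^- _)).
rewrite exchange_big /=; apply: ler_sum => G _.
apply: (@le_trans _ _ (#|G|%:R ^- t * \sum_(f : t.-tuple H) (<<[set x in f]>>%G == G)%:R)).
  rewrite mulr_sumr; apply: ler_sum => f _.
  by case: eqP => [<-|]; rewrite ?mulr0.
by rewrite mulrC ler_pdivrMr ?exprn_gt0 ?ltr0n ?cardG_gt0// mul1r sum_tuple_gen_le.
Qed.

Lemma gen_weight0E :
  gen_weight 0 t = h%:R ^- t * \sum_(f : t.-tuple H) (generates f)%:R.
Proof.
rewrite /gen_weight addn0 mulr_sumr; apply: eq_bigr => f _.
by rewrite stair_weight0; case: (boolP (generates f)) => gf; rewrite ?mulr0 ?ngen_generates.
Qed.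

Lemma card_gt0R : 0 < h%:R :> F.
Proof. by rewrite ltr0n; apply/card_gt0P; exists 1%g. Qed.

Lemma gen_weight0_le1 : gen_weight 0 t <= 1.
Proof.
rewrite gen_weight0E mulrC ler_pdivrMr ?exprn_gt0 ?card_gt0R// mul1r.
rewrite -natrX -card_tuple -sumr_const; apply: ler_sum => f _.
by rewrite lern1 leq_b1.
Qed.

(** Union bound: a tuple that does not generate lies in a proper subgroup, which has index at least
    2. *)
Lemma gen_weight0_ge : 1 - #|{: {group H}}|%:R * 2 ^- t <= gen_weight 0 t.
Proof.
have ht : 0 < h%:R ^+ t :> F by rewrite exprn_gt0 ?card_gt0R.
rewrite gen_weight0E [leRHS]mulrC ler_pdivlMr//.
rewrite mulrBl mul1r lerBlDr -lerBlDl.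
have -> : h%:R ^+ t - \sum_(f : t.-tuple H) (generates f)%:R =
   \sum_(f : t.-tuple H) (~~ generates f)%:R :> F.
  rewrite -natrX -card_tuple -sumr_const -sumrB; apply: eq_bigr => f _.
  by case: generates; rewrite ?subrr ?subr0.
rewrite -mulrA -sumr_const mulr_suml.
under [leLHS]eq_bigr => f _ do rewrite (sum_group_split f (~~ _)%:R).
rewrite exchange_big /=; apply: ler_sum => G _; rewrite mul1r.
have [GT|GT] := eqVneq (G : {set H}) [set: H].
  rewrite big1 ?mulr_ge0 ?invr_ge0 ?exprn_ge0 ?ler0n// => f _.
  case: eqP => [e|_]; last by rewrite mulr0.
  have -> : generates f by rewrite /generates -GT -e.
  by rewrite mul0r.
apply: (@le_trans _ _ (#|G|%:R ^+ t)).
  apply: le_trans (sum_tuple_gen_le t G); apply: ler_sum => f _.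
  by rewrite ler_piMl ?ler0n// lern1 leq_b1.
rewrite mulrC -expr_div_n lerXn2r ?nnegrE ?divr_ge0 ?ler0n//.
rewrite ler_pdivlMr// -natrM ler_nat.
have := Lagrange (subsetT G); rewrite cardsT => <-; rewrite leq_mul2l.
apply/orP; right; rewrite indexg_gt1; apply: contra GT => TG.
by rewrite eqEsubset TG subsetT.
Qed.

(** * Accumulated error along the recursion *)

Variables (L m : nat).
Hypothesis tE : t = (m + d.-1 * L)%N.
Hypothesis m_large : h%:R * 2 ^- m <= 4^-1 :> F.
Local Notation C := (#|{: {group H}}|%:R : F).
(** The exponent falls from [t] at [k = 0] to [m] at [k = L]. The error bound [z k] doubles with
    each row, so the sum of all errors is comparable to the last one. *)
Local Notation e k := (m + d.-1 * (L - k))%N.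
Local Notation z k := (h%:R * 2 ^- m * 2 ^- (L - k) : F).

Lemma error_term_ge0 k : 0 <= z k.
Proof. by rewrite !mulr_ge0 ?invr_ge0 ?exprn_ge0 ?ler0n. Qed.

Lemma error_term_le k : z k <= 4^-1.
Proof.
apply: le_trans m_large; rewrite ler_piMr ?mulr_ge0 ?invr_ge0 ?exprn_ge0//.
by rewrite invf_le1 ?exprn_gt0// exprn_ege1// ler1n.
Qed.

Lemma error_term_succ k : (k < L)%N -> z k.+1 = 2 * z k.
Proof.
by move=> kL; rewrite -[(L - k)%N]prednK ?subn_gt0// -subnS exprS invfM; field;
   rewrite !expf_neq0 ?pnatr_eq0.
Qed.

Lemma exponent_succ k : (k < L)%N -> (e k.+1 + d.-1 = e k)%N.
Proof. by move=> kL; rewrite -addnA -mulnSr -subSn// subSS. Qed.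

Lemma step_error_le k : h%:R * 2 ^- e k <= z k.
Proof.
rewrite -mulrA ler_wpM2l// -invfM -exprD.
rewrite lef_pV2 ?posrE ?exprn_gt0// ler_eXn2l ?ltr1n// leq_add2l.
by rewrite -{1}[(L - k)%N]mul1n leq_mul2r; apply/orP; right; lia.
Qed.

Lemma total_weight_ge0 k e0 : 0 <= total_weight k e0.
Proof. by apply: sumr_ge0 => f _; apply: stair_weight_ge0. Qed.

Lemma total_weight_le k : (k <= L)%N ->
  total_weight k (e k) <= C * (1 + 4 * z k).
Proof.
elim: k => [_|k IH kL].
  have := error_term_ge0 0; rewrite subn0 -tE => z0; apply: le_trans total_weight0_le _.
  by rewrite ler_peMr// lerDl mulr_ge0.
apply: le_trans (total_weight_step _ _) _; rewrite exponent_succ//.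
have C0 : 0 <= C by [].
have W := IH (ltnW kL); have W0 := total_weight_ge0 k (e k).
have x1 := step_error_le k.+1; rewrite error_term_succ// in x1 *.
have z0 := error_term_ge0 k; have z1 := error_term_le k.
have x0 : 0 <= h%:R * 2 ^- e k.+1 :> F by rewrite mulr_ge0 ?invr_ge0 ?exprn_ge0.
move: (h%:R * 2 ^- e k.+1) x0 x1 => x x0 x1.
move: (z k) z0 z1 W x1 => y y0 y1 W x1.
apply: (@le_trans _ _ (C * (1 + 4 * y) * (1 + 2 * y))).
  apply: ler_pM => //; first by rewrite addr_ge0.
  by rewrite lerD2l.
(* For [y] at most 1/4, [(1 + 4 * y) * (1 + 2 * y)] is at most [1 + 8 * y]; this is where the
   constant of [m_large] comes from. *)
by rewrite -mulrA ler_wpM2l//; nra.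
Qed.

Lemma gen_weight_le k : (k <= L)%N ->
  gen_weight k (e k) <= 1 + 4 * C * z k.
Proof.
elim: k => [_|k IH kL].
  have := error_term_ge0 0; rewrite subn0 -tE => z0; apply: le_trans gen_weight0_le1 _.
  by rewrite lerDl; apply: mulr_ge0 => //; apply: mulr_ge0.
apply: le_trans (gen_weight_step_le _ _) _; rewrite exponent_succ//.
have U := IH (ltnW kL); have W := total_weight_le (ltnW kL).
have x1 := step_error_le k.+1; rewrite error_term_succ// in x1 *.
have W0 := total_weight_ge0 k (e k).
have z0 := error_term_ge0 k; have z1 := error_term_le k.
have C0 : 0 <= C by [].
have x0 : 0 <= h%:R * 2 ^- e k.+1 :> F by rewrite mulr_ge0 ?invr_ge0 ?exprn_ge0.
move: (h%:R * 2 ^- e k.+1) x0 x1 => x x0 x1.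
have {}W : total_weight k (e k) <= 2 * C.
  by apply: le_trans W _; rewrite mulrC ler_wpM2r//; lra.
have WX : total_weight k (e k) * x <= 2 * C * (2 * z k) by apply: ler_pM.
move: (z k) U WX => y U WX.
(* The total weight is at most [2 * C] and the step error at most [2 * y], so a step adds
   [4 * C * y], just what doubling [y] permits. *)
rewrite [leRHS](_ : _ = (1 + 4 * C * y) + 2 * C * (2 * y)); last by ring.
exact: lerD.
Qed.

(** The quantity never decreases with [k], so the bound at [k = 0] persists. *)
Lemma gen_weight_ge k : (k <= L)%N -> 1 - C * 2 ^- m <= gen_weight k (e k).
Proof.
elim: k => [_|k IH kL]; last first.
  apply: le_trans (IH (ltnW kL)) _; rewrite -exponent_succ//.
  exact: gen_weight_step_ge.
rewrite subn0 -tE; apply: le_trans gen_weight0_ge.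
rewrite lerD2l lerN2 ler_wpM2l// lef_pV2 ?posrE ?exprn_gt0//.
by rewrite ler_eXn2l ?ltr1n// tE leq_addr.
Qed.

Lemma gen_weight_dist : `|gen_weight L m - 1| <= 4 * C * h%:R * 2 ^- m.
Proof.
have := gen_weight_le (leqnn L); have := gen_weight_ge (leqnn L).
rewrite subnn muln0 addn0 expr0 invr1 mulr1 mulrA => lo hi.
rewrite ler_distl; apply/andP; split; last exact: hi.
apply: le_trans lo; rewrite lerD2l lerN2 ler_wpM2r ?invr_ge0 ?exprn_ge0//.
rewrite -!natrM ler_nat; have : (0 < h)%N by apply/card_gt0P; exists 1%g.
by nia.
Qed.

End Staircase.

End GeneratedSum.

(** * Presentations of cokernels *)

From mathcomp Require Import ring_quotient generic_quotient boolp.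

Local Open Scope quotient_scope.

Lemma cok_isoP (R : comNzRingType) n (A : 'M[R]_n) (H : zmodType) :
  zmod_iso (cok A) H <->
  exists h : {additive 'cV[R]_n -> H}, (forall x, exists v, h v = x) /\
    (forall v, h v = 0 <-> exists u, v = A *m u).
Proof.
split=> [[f [g fK gK]]|[h [hsurj hker]]].
  pose Q := Quotient.quot (colspan A).
  have piB : zmod_morphism (\pi_Q : 'cV[R]_n -> Q) by move=> v w; rewrite raddfB.
  have hB : zmod_morphism (fun v => f (\pi_Q v)) by move=> v w; rewrite piB raddfB.
  pose hM := GRing.isZmodMorphism.Build _ _ (fun v => f (\pi_Q v)) hB.
  pose h : {additive 'cV[R]_n -> H} := HB.pack (fun v => f (\pi_Q v)) hM.
  exists h; split=> [x|v]; first by exists (repr (g x)); rewrite /= reprK gK.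
  have -> : (h v = 0) <-> (v \in colspan A).
    rewrite -[v in v \in _]subr0 Quotient.idealrBE.
    split=> [fv0|/eqP e].
      by apply/eqP/(can_inj fK); rewrite -[LHS]/(h v) -[RHS]/(h 0) fv0 raddf0.
    by rewrite -[LHS]/(f (\pi_Q v)) e -[LHS]/(h 0) raddf0.
  by split=> [/asboolP//|?]; apply/asboolP.
have hE v w : \pi_(Quotient.quot (colspan A)) v = \pi w <-> h v = h w.
  have -> : (h v = h w) <-> (v - w \in colspan A).
    have -> : (h v = h w) <-> (h (v - w) = 0).
      rewrite raddfB; split=> [->|/eqP]; first by rewrite subrr.
      by rewrite subr_eq0 => /eqP.
    by rewrite hker; split=> [?|/asboolP//]; apply/asboolP.
  by rewrite Quotient.idealrBE; split=> [->|/eqP].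
pose f (x : cok A) : H := h (repr x).
have fE v : f (\pi v) = h v by apply/hE; rewrite reprK.
have fB : zmod_morphism f.
  move=> x y; have -> : x - y = \pi_(Quotient.quot (colspan A)) (repr x - repr y).
    by rewrite raddfB /= !reprK.
  by rewrite fE raddfB.
pose fM := GRing.isZmodMorphism.Build _ _ f fB.
pose f' : {additive cok A -> H} := HB.pack f fM.
exists f'.
have [g gP] := choice hsurj.
exists (fun x => \pi_(Quotient.quot (colspan A)) (g x)) => x /=; last by rewrite fE gP.
by rewrite -[RHS]reprK; apply/hE; rewrite gP.
Qed.

Section PadicCokernel.
Context (p k : nat) (p_pr : prime p) (H : finZmodType).
Hypothesis Hk : forall x : H, x *+ p ^ k = 0.
Variables (n : nat) (X : 'M[padic_int p]_n).
Local Notation Zp := (padic_int p).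
Local Notation q := (p ^ k.+1)%N.
Local Notation Zq := ('Z_(p ^ k.+1)).
Local Notation red := (map_mx (padic_red k)).
Local Notation V := ('cV[Zq]_n).

Lemma red_lift m (v : 'M[Zq]_(n, m)) : exists w : 'M[Zp]_(n, m), red w = v.
Proof.
exists (map_mx (fun a : Zq => (a : nat)%:R) v).
by apply/matrixP => i j; rewrite !mxE padic_lift.
Qed.

Lemma red_eq0 m (v : 'M[Zp]_(n, m)) : red v = 0 -> exists w, v = w *+ q.
Proof.
move=> v0; have h i j : exists y, v i j = y *+ q.
  apply: padic_red_eq0 => //; have /matrixP /(_ i j) := v0.
  by rewrite !mxE.
have /choice[g gP] : forall ij, exists y, v ij.1 ij.2 = y *+ q by move=> ij; apply: h.
exists (\matrix_(i, j) g (i, j)); apply/matrixP => i j.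
by rewrite mulmxnE mxE -gP.
Qed.

(** Additivity alone suffices: [h] kills multiples of [q], and up to these every vector is a
    combination of basis vectors with natural coefficients. *)
Lemma additive_lincomb (h : {additive 'cV[Zp]_n -> H}) v :
  h v = lincomb [tuple h (delta_mx i 0) | i < n] (red v).
Proof.
have hq w : h (w *+ q) = 0 by rewrite raddfMn expnSr mulrnA Hk mul0rn.
have -> : h v = h (\sum_(i < n) delta_mx i 0 *+ (red v i 0%R : nat)).
  apply/eqP; rewrite -subr_eq0 -raddfB; set w := v - _.
  suff [u ->] : exists u, w = u *+ q by rewrite hq.
  apply: red_eq0; apply/matrixP => i j; rewrite ord1 !mxE raddfB /=.
  rewrite summxE (bigD1 i)//= big1 => [|l li]; last first.
    by rewrite mulmxnE mxE eq_sym (negbTE li) mul0rn.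
  rewrite addr0 mulmxnE !mxE !eqxx.
  by rewrite -[X in _ - X]/(padic_red k (_ : nat)%:R) padic_lift subrr.
rewrite raddf_sum; apply: eq_bigr => i _.
by rewrite raddfMn -tnth_nth tnth_mktuple.
Qed.

(* [p^k I = X W + p^(k+1) Z] and [I - p Z] is invertible, so the column span
   of [X] contains [p^k Z_p^n]. *)
Lemma colspan_absorbs (W Z : 'M[Zp]_n) :
  (p ^ k)%:R%:M = X *m W + Z *+ q ->
  forall z : 'cV[Zp]_n, exists u, z *+ p ^ k = X *m u.
Proof.
move=> E z; pose B := 1%:M - Z *+ p.
have E' : B *+ p ^ k = X *m W.
  rewrite mulrnBl -mulrnA -expnS -[X *m W](addrK (Z *+ q)) -E; congr (_ - _).
  by rewrite -scaler_nat scalemx1.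
have redB : padic_red 0 (\det B) = 1.
  rewrite -det_map_mx -[RHS](det1 _ n); congr (\det _).
  apply/matrixP => i j; rewrite !mxE raddfB mulmxnE raddfMn /= raddfMn /=.
  have p0 : p%:R = 0 :> 'Z_(p ^ 1) by rewrite -(pchar_Zp (pexp_gt1 p_pr 0)) expn1.
  by rewrite -[_ *+ p]mulr_natr p0 mulr0 subr0.
have [y yP] := padic_unit p_pr redB.
exists (W *m (\adj B *m (y *: z))).
rewrite mulmxA -E' -[B *+ _]scaler_nat -scalemxAl mulmxA mul_mx_adj.
by rewrite mul_scalar_mx (scalerA (\det B)) yP scale1r scaler_nat.
Qed.

(** From right to left, lifting [f] gives a surjection whose kernel is the column span plus all
    multiples of [q]. As [p ^ k] kills [H], [colspan_absorbs] puts those multiples in the column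
    span. *)
Lemma cok_iso_redP : zmod_iso (cok X) H <->
  exists f : n.-tuple H, <<[set x in f]>>%g = [set: H] /\
    [set red X *m u | u : V] = relations p k n f n.
Proof.
split.
  case/cok_isoP => h [hsurj hker].
  pose f := [tuple h (delta_mx i 0) | i < n].
  have hE v : h v = lincomb f (red v) := additive_lincomb h v.
  exists f; split.
    apply/setP => x; rewrite inE.
    have := lincomb_initial_coords p_pr Hk n (size_tuple f).
    rewrite take_oversize ?size_tuple// => <-.
    have [v <-] := hsurj x; rewrite hE; apply/imsetP; exists (red v) => //.
    by apply/initial_coordsP => i; rewrite leqNgt ltn_ord.
  apply/setP => v; rewrite relationsT; apply/imsetP/eqP.
    case=> u _ ->; have [w <-] := red_lift u.
    by rewrite -map_mxM -hE; apply/hker; exists w.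
  have [w <-] := red_lift v; rewrite -hE => /hker[u ->].
  by exists (red u) => //; rewrite map_mxM.
case=> f [gf fE]; apply/cok_isoP.
pose h0 (v : 'cV[Zp]_n) : H := lincomb f (red v).
have hB : zmod_morphism h0.
  by move=> v w; rewrite /h0 map_mxB lincombB.
pose hM := GRing.isZmodMorphism.Build _ _ h0 hB.
pose h : {additive 'cV[Zp]_n -> H} := HB.pack h0 hM.
have kerP v : h v = 0 <-> exists u z, v = X *m u + z *+ q.
  split=> [hv|[u [z ->]]].
    have : red v \in relations p k n f n by rewrite relationsT; apply/eqP.
    rewrite -fE => /imsetP[u _ e]; have [w wu] := red_lift u.
    have [z zE] : exists z, v - X *m w = z *+ q.
      by apply: red_eq0; rewrite map_mxB map_mxM wu -e subrr.
    by exists w, z; rewrite -zE addrC subrK.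
  rewrite raddfD raddfMn expnSr mulrnA Hk mul0rn addr0; apply/eqP.
  rewrite -[h _]/(lincomb _ _) map_mxM -relationsT// -fE.
  by apply/imsetP; exists (red u).
exists h; split=> [x|v].
  have [v <-] := lincomb_surj p_pr Hk gf x; have [w <-] := red_lift v.
  by exists w.
split=> [/kerP[u [z ->]]|[u ->]]; last first.
  by apply/kerP; exists u, 0; rewrite mul0rn addr0.
have hk i : exists uz : 'cV[Zp]_n * 'cV[Zp]_n,
    delta_mx i 0 *+ p ^ k = X *m uz.1 + uz.2 *+ q.
  have /kerP[u' [z' e]] : h (delta_mx i 0 *+ p ^ k) = 0 by rewrite raddfMn Hk.
  by exists (u', z').
have [g gP] := choice hk.
have E : (p ^ k)%:R%:M = X *m (\matrix_(i, j) (g j).1 i 0) +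
                          (\matrix_(i, j) (g j).2 i 0) *+ q.
  apply/matrixP => i j; have /matrixP/(_ i 0) e := gP j.
  transitivity ((delta_mx j 0 *+ p ^ k : 'cV[Zp]_n) i 0).
    by rewrite mulmxnE !mxE eqxx andbT; case: (i == j); rewrite ?mul0rn.
  rewrite e [LHS]mxE [RHS]mxE !mulmxnE; congr (_ + _); last by rewrite mxE.
  by rewrite !mxE; apply: eq_bigr => l _; rewrite mxE.
have [u' e] := colspan_absorbs E (z *+ p).
by exists (u + u'); rewrite mulmxDr -e -mulrnA -expnS.
Qed.

End PadicCokernel.

(** * Law of the reduced matrix *)

From mathcomp Require Import all_classical all_reals all_analysis.
Import numFieldNormedType.Exports.

Local Open Scope classical_set_scope.

Section FiniteLaw.
Context (d : measure_display) (Omega : measurableType d) (R : realType).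
Variable P : probability Omega R.

Lemma measurable_fiber_seq (T : eqType) (f : Omega -> T) (s : seq T) :
  (forall a, measurable [set w | f w = a]) ->
  measurable [set w | f w \in s].
Proof.
move=> mf; elim: s => [|a s IH].
  by rewrite (_ : [set w | _] = set0)//; apply/seteqP; split=> w.
rewrite (_ : [set w | _] = [set w | f w = a] `|` [set w | f w \in s]).
  exact: measurableU.
apply/seteqP; split=> w /=; rewrite inE.
  by case/orP => [/eqP|]; [left|right].
by case=> [->|->]; rewrite ?eqxx ?orbT.
Qed.

Lemma prob_fiber_sum (T : finType) (f : Omega -> T) (Q : pred T) :
  (forall a, measurable [set w | f w = a]) ->
  P [set w | Q (f w)] = (\sum_(a | Q a) P [set w | f w = a])%E.
Proof.
move=> mf.
have -> : [set w | Q (f w)] = [set w | f w \in enum Q].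
  by apply/seteqP; split=> w /=; rewrite mem_enum.
rewrite (eq_bigl (fun a => a \in Q))// -big_enum /=.
elim: (enum Q) (enum_uniq Q) => [|a s IH] /=.
  by rewrite big_nil (_ : [set w | _] = set0) ?measure0//; apply/seteqP; split=> w.
case/andP=> as_ us; rewrite big_cons -IH//.
rewrite -measureU//; last 2 first.
- exact: measurable_fiber_seq.
- by apply/seteqP; split=> w //= [-> h]; move: as_; rewrite h.
congr (P _); apply/seteqP; split=> w /=; rewrite inE.
  by case/orP => [/eqP|]; [left|right].
by case=> [->|->]; rewrite ?eqxx ?orbT.
Qed.

End FiniteLaw.

Section HaarReduction.
Context (d : measure_display) (Omega : measurableType d) (R : realType).
Variable P : probability Omega R.
Context (p k : nat) (p_pr : prime p).
Local Notation Zp := (padic_int p).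
Local Notation q := (p ^ k.+1)%N.
Local Notation Zq := ('Z_(p ^ k.+1)).

Lemma measurable_residue (a : Zq) : measurable [set x : Zp | padic_red k x = a].
Proof.
apply: sub_sigma_algebra.
suff: padic_open [set x : Zp | padic_red k x = a] by [].
by move=> x /= xa; exists k => y yx; rewrite -xa.
Qed.

(** The [q] residue classes are translates of one another, hence equally likely, and they partition
    the space. *)
Lemma haar_residue (Y : Omega -> Zp) (a : Zq) : haar_distributed P Y ->
  P [set w | padic_red k (Y w) = a] = (q%:R^-1)%:E.
Proof.
case=> mY hY.
have mf b : measurable [set w | padic_red k (Y w) = b].
  have := mY measurableT _ (measurable_residue b).
  by rewrite setTI.
have eqP0 b : P [set w | padic_red k (Y w) = b] = P [set w | padic_red k (Y w) = 0].
  have := hY (b : nat)%:R _ (measurable_residue 0); rewrite /pushforward.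
  move=> <-; congr (P _); apply/seteqP; split=> w /=.
    move=> wb; exists (Y w - (b : nat)%:R); last by rewrite addrC subrK.
    by rewrite raddfB /= wb padic_lift subrr.
  by case=> x x0 <-; rewrite raddfD /= x0 addr0 padic_lift.
have := prob_fiber_sum P xpredT mf.
rewrite (_ : [set w | _] = setT); last by apply/seteqP; split.
rewrite probability_setT (eq_bigr (fun=> P [set w | padic_red k (Y w) = 0])) => [|b _//].
rewrite eqP0.
have : P [set w | padic_red k (Y w) = 0] \is a fin_num by apply: fin_num_measure.
move: (P _) => [c||]// _.
rewrite sumEFin sumr_const card_ord modulus_pexp// => -[] h.
have q0 : q%:R != 0 :> R by rewrite pnatr_eq0 -lt0n expn_gt0 prime_gt0.
by congr (_%:E); apply: (mulIf q0); rewrite mulVf// mulr_natr -h.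
Qed.

Variables (n : nat) (Sigma : 'I_n -> {set 'I_n}) (X : Omega -> 'M[Zp]_n).
Hypothesis hX : haar_random_matrix P Sigma X.
Local Notation red := (map_mx (padic_red k)).

Lemma supported_fiberE (A : 'M[Zq]_n) :
  (forall i j, i \notin Sigma j -> A i j = 0) ->
  [set w | red (X w) = A] =
  \bigcap_(ij in [set` [set ij : 'I_n * 'I_n | ij.1 \in Sigma ij.2]%SET])
    (fun w => X w ij.1 ij.2) @^-1` [set x | padic_red k x = A ij.1 ij.2].
Proof.
case: hX => X0 _ _ A0; apply/seteqP; split=> w /=.
  by move=> <- ij _ /=; rewrite mxE.
move=> h; apply/matrixP => i j; rewrite mxE.
have [ij|ij] := boolP (i \in Sigma j); last by rewrite X0// A0// raddf0.
by apply: (h (i, j)); rewrite /= inE.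
Qed.

Lemma prob_supported_fiber (A : 'M[Zq]_n) :
  (forall i j, i \notin Sigma j -> A i j = 0) ->
  P [set w | red (X w) = A] = (\prod_(j < n) (q ^ #|Sigma j|)%:R^-1)%:E.
Proof.
move=> A0; rewrite supported_fiberE//; case: hX => _ Xh Xi.
pose B (ij : 'I_n * 'I_n) := [set x : Zp | padic_red k x = A ij.1 ij.2].
rewrite (Xi _ B) // => [|ij]; last exact: measurable_residue.
rewrite (eq_bigr (fun=> (q%:R^-1)%:E)); last first.
  by move=> ij; rewrite inE => ijS; apply/haar_residue/Xh.
rewrite prodEFin; congr (_%:E).
rewrite (eq_bigl (fun ij : 'I_n * 'I_n => xpredT ij.2 && (ij.1 \in Sigma ij.2))); last first.
  by move=> ij; rewrite inE.
rewrite (reindex_inj (h := fun ji : 'I_n * 'I_n => (ji.2, ji.1))) /=; last first.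
  by move=> [a b] [a' b'] [-> ->].
rewrite -(pair_big_dep xpredT (fun j i => i \in Sigma j) (fun _ _ => q%:R^-1)) /=.
by apply: eq_bigr => j _; rewrite prodr_const exprVn -natrX.
Qed.

Lemma prob_matrix_event (Q : pred 'M[Zq]_n) :
  P [set w | Q (red (X w))] =
  (\sum_(A : 'M[Zq]_n | Q A && [forall j, forall i, (i \notin Sigma j) ==> (A i j == 0)])
     \prod_(j < n) (q ^ #|Sigma j|)%:R^-1)%:E.
Proof.
have suppP (A : 'M[Zq]_n) :
    reflect (forall i j, i \notin Sigma j -> A i j = 0)
      [forall j, forall i, (i \notin Sigma j) ==> (A i j == 0)].
  apply: (iffP forallP) => [h i j ij|h j].
    by have /forallP/(_ i)/implyP/(_ ij)/eqP := h j.
  by apply/forallP => i; apply/implyP => ij; rewrite h.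
(* Matrices violating the support are never reached, so they drop out of the sum. *)
have emptyE (A : 'M[Zq]_n) :
    ~~ [forall j, forall i, (i \notin Sigma j) ==> (A i j == 0)] ->
    [set w | red (X w) = A] = set0.
  move=> /suppP nA; apply/seteqP; split=> w //= E; apply: nA => i j ij.
  by case: hX => X0 _ _; rewrite -E mxE X0// raddf0.
rewrite prob_fiber_sum => [|A]; last first.
  have [/suppP sA|/emptyE->//] := boolP [forall j, forall i, (i \notin Sigma j) ==> (A i j == 0)].
  rewrite supported_fiberE//; apply: fin_bigcap_measurable; first exact: finite_finset.
  move=> ij; rewrite /= inE => ijS; case: hX => _ /(_ _ _ ijS)[mY _] _.
  by have := mY measurableT _ (measurable_residue (A ij.1 ij.2)); rewrite setTI.
rewrite (bigID (fun A : 'M[Zq]_n => [forall j, forall i, (i \notin Sigma j) ==> (A i j == 0)])) /=.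
rewrite [X in (_ + X)%E]big1 ?adde0 => [|A /andP[_ /emptyE ->]]; last exact: measure0.
rewrite -sumEFin; apply: eq_bigr => A /andP[_ /suppP sA].
by rewrite prob_supported_fiber.
Qed.

End HaarReduction.

(** * Probability of a given cokernel *)

Lemma card_initial n m : (m <= n)%N -> #|initial n m| = m.
Proof.
move=> mn; rewrite -sum1_card (eq_bigl (fun i : 'I_n => (i < m)%N)); last first.
  by move=> i; rewrite inE.
by rewrite -(big_ord_widen _ (fun=> 1%N))// sum1_card card_ord.
Qed.

Lemma cok_prob_exact (R : realType) (disp : measure_display)
    (Omega : measurableType disp) (P : probability Omega R) p n (s : nat -> nat)
    (X : Omega -> 'M[padic_int p]_n) (H : finZmodType) :
  prime p -> (p.-group [set: H]%G)%g ->
  (forall i, s i <= n)%N -> (forall i j, i <= j -> s i <= s j)%N ->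
  haar_random_matrix P (fun j => initial n (s j)) X ->
  P [set w | zmod_iso (cok (X w)) H] =
  (#|Aut [set: H]%G|%:R^-1 * (\prod_(j < n) (1 - p%:R ^+ j / p%:R ^+ s j) *
    \sum_(f : n.-tuple H) \prod_(j < n) (ngen (take (s j) f))%:R^-1 *
      (generates f)%:R))%:E.
Proof.
move=> p_pr pH sn smono hX.
(* With this [k], [p ^ k] is the order of [H], so it kills [H]. *)
pose k := logn p #|[set: H]%G|.
have Hk (x : H) : x *+ p ^ k = 0.
  rewrite /k -(card_pgroup pH) -FinRing.zmodXgE.
  by rewrite expg_cardG ?inE.
pose Q (A : 'M['Z_(p ^ k.+1)]_n) := [exists f : n.-tuple H, generates f &&
   ([set A *m u | u : 'cV_n]%SET == relations p k n f n)].
have -> : [set w | zmod_iso (cok (X w)) H] =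
          [set w | Q (map_mx (padic_red k) (X w))].
  apply/seteqP; split=> w /=.
    move=> /(cok_iso_redP p_pr Hk)[f [gf fE]]; apply/existsP; exists f.
    by rewrite fE eqxx andbT; apply/eqP.
  case/existsP => f /andP[/eqP gf /eqP fE]; apply/(cok_iso_redP p_pr Hk).
  by exists f.
rewrite (prob_matrix_event p_pr hX); congr (_%:E).
pose supp (A : 'M['Z_(p ^ k.+1)]_n) :=
  [forall j : 'I_n, col j A \in initial_coords p k n (s j)].
have suppE (A : 'M['Z_(p ^ k.+1)]_n) :
    [forall j : 'I_n, forall i, (i \notin initial n (s j)) ==> (A i j == 0)] = supp A.
  apply: eq_forallb => j; rewrite inE; apply: eq_forallb => i.
  by rewrite inE -leqNgt mxE.
under eq_bigl do rewrite suppE.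
have aut0 : #|Aut [set: H]%G|%:R != 0 :> R.
  by rewrite pnatr_eq0 -lt0n cardG_gt0.
(* The indicator of the event becomes a normalized count of presentations, so that the sums over [A]
   and [f] can be exchanged. *)
have QE (A : 'M['Z_(p ^ k.+1)]_n) : (Q A)%:R = #|Aut [set: H]%G|%:R^-1 *
    \sum_(f : n.-tuple H) (generates f && ([set A *m u | u : 'cV_n]%SET ==
       relations p k n f n))%:R :> R.
  rewrite -natr_sum; have [/existsP[f0 /andP[/eqP gf0 /eqP f0E]]|nQ] := boolP (Q A).
    rewrite [X in _ * X%:R](_ : _ = #|Aut [set: H]%G|) ?mulVf//.
    rewrite -(card_presentations p_pr Hk gf0) -sum1_card [RHS]big_mkcond /=.
    apply: eq_bigr => f _; rewrite inE f0E [relations _ _ _ f0 _ == _]eq_sym.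
    by rewrite /generates; case: ifP.
  rewrite big1 ?mulr0// => f _; case: (boolP (_ && _)) => // h.
  by case/existsP: nQ; exists f.
rewrite big_mkcond /=.
pose c := \prod_(j < n) ((p ^ k.+1) ^ #|initial n (s j)|)%:R^-1 : R.
transitivity (#|Aut [set: H]%G|%:R^-1 * \sum_(f : n.-tuple H) (generates f)%:R *
   (c * \sum_(A : 'M['Z_(p ^ k.+1)]_n) (supp A &&
     ([set A *m u | u : 'cV_n]%SET == relations p k n f n))%:R)).
  transitivity (\sum_(A : 'M['Z_(p ^ k.+1)]_n) c * ((Q A)%:R * (supp A)%:R)).
    apply: eq_bigr => A _; rewrite -/c.
    by case: (Q A); case: (supp A); rewrite /= ?mul1r ?mulr1 ?mul0r ?mulr0.
  under eq_bigr => A _ do rewrite QE -mulrA mulrCA mulr_suml mulr_sumr.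
  rewrite -mulr_sumr exchange_big /=; congr (_ * _); apply: eq_bigr => f _.
  rewrite !mulr_sumr; apply: eq_bigr => A _; rewrite -!mulnb !natrM; ring.
congr (_ * _); rewrite mulr_sumr; apply: eq_bigr => f _.
rewrite (count_spanning_matrices p_pr Hk R (size_tuple f) sn smono).
rewrite mulrC mulrA; congr (_ * _).
rewrite /c -!big_split /=; apply: eq_bigr => j _.
rewrite card_initial// -/(ngen _).
have q0 : ((p ^ k.+1) ^ s j)%:R != 0 :> R.
  by rewrite pnatr_eq0 -lt0n !expn_gt0 prime_gt0.
by rewrite !mulrA mulVf// mul1r mulrC.
Qed.

(** * Staircase supports *)

(* Columns are indexed from [0], so [j] stands for the paper's [j + 1]. *)
Definition stair_height (d t n j : nat) : nat :=
  if (j < d * (n - t))%N then (t + j %/ d)%N else n.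

Section StairHeight.
Variables (d t n : nat).
Hypotheses (d_gt0 : (0 < d)%N) (tn : (t <= n)%N).

(** The ceiling of (j+1)/d, minus 1, is the floor of j/d. *)
Lemma staircaseE (j : 'I_n) : staircase d t j = initial n (stair_height d t n j).
Proof.
rewrite /staircase /stair_height; case: ifP => // _; congr initial.
rewrite /ceil_div divnS//; case: (d %| j.+1)%N => /=; last by rewrite addn1 subn1.
by rewrite addn0 add1n subn1.
Qed.

Lemma stair_height_le j : (stair_height d t n j <= n)%N.
Proof.
rewrite /stair_height; case: ifP => // jd.
have : (j %/ d < n - t)%N by rewrite ltn_divLR// mulnC.
by lia.
Qed.

Lemma stair_height_mono i j : (i <= j)%N ->
  (stair_height d t n i <= stair_height d t n j)%N.
Proof.
move=> ij; rewrite {2}/stair_height; case: ifP => jd; last exact: stair_height_le.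
by rewrite /stair_height (leq_ltn_trans ij jd) leq_add2l leq_div2r.
Qed.

End StairHeight.

(** The short columns come in [n - t] blocks of [d] columns of equal height; the remaining columns
    are full. *)
Lemma prod_stair_height (R : comNzRingType) (d t n : nat) (F : nat -> R) :
  (0 < d)%N -> (d * (n - t) <= n)%N ->
  \prod_(j < n) F (stair_height d t n j) =
  \prod_(i < n - t) F (t + i)%N ^+ d * F n ^+ (n - d * (n - t)).
Proof.
move=> d0 dn.
rewrite -(big_mkord xpredT (fun j => F (stair_height d t n j))).
rewrite (@big_cat_nat _ _ _ (d * (n - t))) //=; congr (_ * _).
  rewrite mulnC big_nat_mul big_mkord; apply: eq_bigr => i _.
  rewrite (@eq_big_nat _ _ _ _ _ _ (fun=> F (t + i)%N)) => [|j /andP[ij ji]].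
    by rewrite prodr_const_nat mulSn addnK.
  rewrite /stair_height mulnC (leq_trans ji); last by rewrite leq_mul2r ltn_ord orbT.
  congr (F (t + _)%N); apply/eqP; rewrite eqn_leq leq_divRL// ij andbT.
  by rewrite -ltnS ltn_divLR.
rewrite (@eq_big_nat _ _ _ _ _ _ (fun=> F n)) => [|j /andP[dj _]].
  by rewrite prodr_const_nat.
by rewrite /stair_height ltnNge dj.
Qed.

Lemma sum_gen_staircase (R : realType) (H : finGroupType) (d t n : nat) :
  (0 < d)%N -> (t <= n)%N -> (d * (n - t) <= n)%N ->
  \sum_(f : n.-tuple H) \prod_(j < n) (ngen (take (stair_height d t n j) f))%:R^-1 *
      (generates f)%:R =
  gen_weight R H d t (n - t) (n - d * (n - t)).
Proof.
move=> d0 tn dn; rewrite /gen_weight subnKC//; apply: eq_bigr => f _.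
rewrite (prod_stair_height (fun i => (ngen (take i f))%:R^-1))// /stair_weight.
congr (_ * _ * _); last by rewrite take_oversize ?size_tuple// exprVn.
by apply: eq_bigr => i _; rewrite exprVn.
Qed.

(** * Product of the spanning probabilities *)

Section StairProduct.
Context (R : realType) (p : nat).
Hypothesis p_ge2 : (2 <= p)%N.

Lemma prod_1B_ge (I : finType) (P : pred I) (x : I -> R) :
  (forall i, P i -> 0 <= x i <= 1) ->
  1 - \sum_(i | P i) x i <= \prod_(i | P i) (1 - x i) <= 1.
Proof.
move=> x01.
(* The Weierstrass inequality goes through the induction only together with the bounds 0 and 1 on
   the product. *)
suff : 1 - \sum_(i | P i) x i <= \prod_(i | P i) (1 - x i) /\
       0 <= \prod_(i | P i) (1 - x i) <= 1 by case=> -> /andP[_ ->].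
apply: (big_ind2 (fun s q => 1 - s <= q /\ 0 <= q <= 1)).
- by rewrite subr0 lexx ler01.
- move=> s q s' q' [h1 /andP[h2 h3]] [h1' /andP[h2' h3']].
  split; first by nra.
  by apply/andP; split; nra.
- by move=> i /x01/andP[h1 h2]; split; [lra|apply/andP; split; lra].
Qed.

Lemma sum_half_pow D :
  \sum_(i < D) 2 ^- (i./2) = 4 - (4 - (odd D)%:R) * 2 ^- (D./2) :> R.
Proof.
elim: D => [|D IH]; first by rewrite big_ord0 /= expr0 invr1; ring.
rewrite big_ord_recr /= IH uphalf_half; case: (odd D) => /=; last by rewrite add0n; ring.
rewrite add1n exprS invfM; field.
by rewrite expf_neq0// pnatr_eq0.
Qed.

(** Counted backwards from the last short column, the [i]-th one has height minus index equal to
    [m + (i - i %/ d)], at least [m + i./2] as [d] is at least 2. The sum of the subtracted terms is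
    then at most [2 ^- m] times the series of [sum_half_pow], whose sum is 4. *)
Lemma stair_product_near1 (d t n : nat) :
  (2 <= d)%N -> (t <= n)%N -> (d * (n - t) <= n)%N ->
  (1 : R) - 4 * 2 ^- (n - d * (n - t)) <=
  \prod_(j < d * (n - t)) (1 - (p%:R : R) ^+ j / p%:R ^+ (t + j %/ d)) <= 1.
Proof.
move=> d2 tn dn; set D := (d * (n - t))%N; set m := (n - D)%N.
have p0 : 0 < p%:R :> R by rewrite ltr0n; lia.
have expo i : (i < D)%N ->
    (t + (D - i.+1) %/ d = (D - i.+1) + (m + (i - i %/ d)))%N.
  move=> iD.
  have d0 : (0 < d)%N by lia.
  have -> : ((D - i.+1) %/ d = (n - t).-1 - i %/ d)%N.
    have iq := divn_eq i d; have ir := ltn_pmod i d0.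
    have qL : (i %/ d < n - t)%N by rewrite ltn_divLR// mulnC.
    have [c cE] : exists c, (n - t = c + (i %/ d).+1)%N.
      by exists (n - t - (i %/ d).+1)%N; lia.
    have -> : ((n - t).-1 - i %/ d = c)%N by lia.
    have -> : (D - i.+1 = c * d + (d.-1 - i %% d))%N.
      by rewrite /D cE; move: iq ir; move: (i %/ d)%N (i %% d)%N => a r; nia.
    by rewrite divnMDl// divn_small ?addn0//; lia.
  have qL : (i %/ d < n - t)%N by rewrite ltn_divLR// mulnC.
  have qi : (i %/ d <= i)%N by apply: leq_div.
  by rewrite /m; lia.
have xE (i : 'I_D) : p%:R ^+ rev_ord i / p%:R ^+ (t + rev_ord i %/ d) =
    p%:R ^- (m + (i - i %/ d)) :> R.
  rewrite /= expo// exprD invfM mulrA mulfV ?mul1r//.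
  by rewrite expf_neq0// gt_eqF.
have xle (i : 'I_D) : p%:R ^- (m + (i - i %/ d)) <= 2 ^- m * 2 ^- (i./2) :> R.
  rewrite -invfM -exprD lef_pV2 ?posrE ?exprn_gt0//.
  apply: (@le_trans _ _ (2 ^+ (m + (i - i %/ d)))); last first.
    by rewrite lerXn2r ?nnegrE ?ler0n// ler_nat.
  rewrite ler_eXn2l ?ltr1n// leq_add2l.
  have : (i %/ d <= i %/ 2)%N by apply: leq_div2l.
  by rewrite divn2 -{2 3}[i : nat]odd_double_half; lia.
rewrite (reindex_inj rev_ord_inj) /=.
under eq_bigr => i _ do rewrite xE.
have /andP[lo ->] : (1 : R) - \sum_(i < D) (p%:R : R) ^- (m + (i - i %/ d)) <=
    \prod_(i < D) (1 - (p%:R : R) ^- (m + (i - i %/ d))) <= 1.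
  apply: prod_1B_ge => i _; rewrite invr_ge0 exprn_ge0 ?(ltW p0)//=.
  by rewrite invf_le1 ?exprn_gt0// exprn_ege1// ler1n; lia.
rewrite andbT; apply: le_trans lo; rewrite lerD2l lerN2.
apply: (@le_trans _ _ (\sum_(i < D) 2 ^- m * 2 ^- (i./2))).
  by apply: ler_sum => i _; apply: xle.
rewrite -mulr_sumr mulrC ler_wpM2r ?invr_ge0 ?exprn_ge0// sum_half_pow.
rewrite gerBl mulr_ge0 ?invr_ge0 ?exprn_ge0//.
by rewrite subr_ge0 ler_nat; case: odd.
Qed.

Lemma prod_full_columns n D : (D <= n)%N ->
  \prod_(D <= j < n) (1 - p%:R ^+ j / p%:R ^+ n) =
  \prod_(1 <= i < (n - D).+1) (1 - p%:R ^- i) :> R.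
Proof.
move=> Dn; have p0 : 0 < p%:R :> R by rewrite ltr0n; lia.
rewrite big_nat_rev /= -{1}[D]add0n big_addn big_add1 /=.
apply: eq_big_nat => i /andP[_ iD]; congr (1 - _).
have -> : n = (D + n - (i + D).+1 + i.+1)%N by lia.
have -> : (D + (D + n - (i + D).+1 + i.+1) - (i + D).+1 = D + n - (i + D).+1)%N by lia.
rewrite exprD invfM mulrA mulfV ?mul1r//.
by rewrite expf_neq0// gt_eqF.
Qed.

Lemma stair_productE (d t n : nat) : (d * (n - t) <= n)%N ->
  \prod_(j < n) (1 - p%:R ^+ j / p%:R ^+ stair_height d t n j) =
  \prod_(j < d * (n - t)) (1 - p%:R ^+ j / p%:R ^+ (t + j %/ d)) *
  \prod_(1 <= i < (n - d * (n - t)).+1) (1 - p%:R ^- i) :> R.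
Proof.
move=> dn; rewrite -prod_full_columns//.
rewrite -(big_mkord xpredT (fun j => 1 - p%:R ^+ j / p%:R ^+ stair_height d t n j)).
rewrite (@big_cat_nat _ _ _ (d * (n - t))) //=; congr (_ * _).
  by rewrite big_mkord; apply: eq_bigr => i _; rewrite /stair_height ltn_ord.
by apply: eq_big_nat => i /andP[Di _]; rewrite /stair_height ltnNge Di.
Qed.

(** [limn] has its meaning only for a convergent sequence; the partial products decrease and are
    nonnegative. *)
Lemma cvg_CL_product :
  (fun m => \prod_(1 <= i < m.+1) (1 - (p%:R : R) ^- i)) @ \oo -->
  limn (fun m => \prod_(1 <= i < m.+1) (1 - (p%:R : R) ^- i)).
Proof.
have f01 i : 0 <= 1 - (p%:R : R) ^- i <= 1.
  have p0 : 0 < p%:R :> R by rewrite ltr0n; lia.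
  rewrite gerBl invr_ge0 exprn_ge0 ?(ltW p0)// andbT subr_ge0.
  by rewrite invf_le1 ?exprn_gt0// exprn_ege1// ler1n; lia.
have prod0 m : 0 <= \prod_(1 <= i < m.+1) (1 - (p%:R : R) ^- i).
  by apply: prodr_ge0 => i _; have /andP[] := f01 i.
apply: nonincreasing_is_cvgn; last first.
  by exists 0 => _ [m _ <-].
apply/nonincreasing_seqP => m; rewrite big_nat_recr//=.
by rewrite ler_piMr//; have /andP[] := f01 m.+1.
Qed.

End StairProduct.

(** * Passage to the limit in the exact formula *)

Theorem theorem3p4 (R : realType) (p d : nat) (t : nat -> nat)
    (disp : nat -> measure_display)
    (Omega : forall n, measurableType (disp n))
    (P : forall n, probability (Omega n) R)
    (X : forall n, Omega n -> 'M[padic_int p]_n)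
    (p_prime : prime p) (d_ge2 : (2 <= d)%N)
    (t_bounds : forall n, (1 <= n)%N -> (1 <= t n <= n)%N)
    (X_haar : forall n, (1 <= n)%N ->
       haar_random_matrix (P n) (staircase d (t n) (n := n)) (X n))
    (lim_full : (n%:R - d%:R * (n%:R - (t n)%:R) : R) @[n --> \oo] --> +oo) :
  converges_to_CL P X.
Proof.
move=> H pH.
pose L n := (n - t n)%N; pose m n := (n - d * L n)%N.
have d0 : (0 < d)%N by lia.
have p2 := prime_gt1 p_prime.
(* The hypothesis concerns a real difference; eventually it is positive, and then the truncated
   subtraction in [m] agrees with it. *)
have m_large M : \forall n \near \oo, [/\ (1 <= n)%N, (M <= m n)%N & (d * L n <= n)%N].
  have /cvgryPge/(_ M.+1%:R) h := lim_full.
  near=> n; have n1 : (1 <= n)%N by near: n; exists 1%N.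
  have /andP[_ tn] := t_bounds n n1.
  have : (M.+1%:R <= n%:R - d%:R * (n%:R - (t n)%:R) :> R) by near: n.
  rewrite -natrB// -natrM lerBrDr -natrD ler_nat /m /L => h'.
  by split=> //; lia.
have m_cvg : m n @[n --> \oo] --> \oo.
  apply/cvgnyPge => M; near=> n.
  by have [] : [/\ (1 <= n)%N, (M <= m n)%N & (d * L n <= n)%N] by near: n.
have pow_cvg : (2 ^- m n : R) @[n --> \oo] --> (0 : R).
  have : (2^-1 : R) ^+ i @[i --> \oo] --> (0 : R).
    by apply: cvg_expr; rewrite ger0_norm ?invr_ge0// invf_lt1// ltr1n.
  move=> /(cvg_comp _ _ m_cvg); apply: cvg_trans; apply: near_eq_cvg.
  by near=> n; rewrite /= exprVn.
pose K := 4 * #|{: {group H}}|%:R * #|H|%:R : R.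
pose Pr n := \prod_(j < d * L n) (1 - (p%:R : R) ^+ j / p%:R ^+ (t n + j %/ d)).
pose U n := gen_weight R H d (t n) (L n) (m n).
have Pr_cvg : Pr n @[n --> \oo] --> (1 : R).
  apply: (@squeeze_cvgr _ _ _ _ (fun n => 1 - 4 * 2 ^- m n) (fun=> 1)).
  - near=> n.
    have [n1 _ dn] : [/\ (1 <= n)%N, (0 <= m n)%N & (d * L n <= n)%N] by near: n.
    have /andP[_ tn] := t_bounds n n1.
    exact: stair_product_near1.
  - rewrite -[X in _ --> X]subr0 -[X in _ - X](mulr0 4).
    by apply: cvgB; [exact: cvg_cst|apply: cvgM => //; exact: cvg_cst].
  - exact: cvg_cst.
have small : \forall n \near \oo, #|H|%:R * 2 ^- m n <= 4^-1 :> R.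
  have : (#|H|%:R * 2 ^- m n : R) @[n --> \oo] --> (0 : R).
    rewrite -[X in _ --> X](mulr0 #|H|%:R).
    by apply: cvgM => //; exact: cvg_cst.
  by move/cvgr_le; apply; rewrite invr_gt0.
have U_cvg : U n @[n --> \oo] --> (1 : R).
  apply: (@squeeze_cvgr _ _ _ _ (fun n => 1 - K * 2 ^- m n) (fun n => 1 + K * 2 ^- m n)).
  - near=> n.
    have [n1 _ dn] : [/\ (1 <= n)%N, (0 <= m n)%N & (d * L n <= n)%N] by near: n.
    have /andP[_ tn] := t_bounds n n1.
    rewrite -ler_distl; apply: gen_weight_dist => //; last by near: n.
    (* This is the identity t = m + (d-1)L, with L = n - t and m = n - dL. *)
    by rewrite /m /L in dn *; move: dn; rewrite -{2 3}(prednK d0) mulSn; lia.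
  - rewrite -[X in _ --> X]subr0 -[X in _ - X](mulr0 K).
    by apply: cvgB; [exact: cvg_cst|apply: cvgM => //; exact: cvg_cst].
  - rewrite -[X in _ --> X]addr0 -[X in _ + X](mulr0 K).
    by apply: cvgD; [exact: cvg_cst|apply: cvgM => //; exact: cvg_cst].
pose B k := \prod_(1 <= i < k.+1) (1 - (p%:R : R) ^- i).
(* Only [B (m n)], from the full columns, has a limit other than 1: [Pr] comes from the short
   columns and [U] from the sum over presentations. *)
have PE : \forall n \near \oo, P n [set w | zmod_iso (cok (X n w)) H] =
    (#|Aut [set: H]%G|%:R^-1 * (Pr n * B (m n) * U n))%:E.
  near=> n.
  have [n1 _ dn] : [/\ (1 <= n)%N, (0 <= m n)%N & (d * L n <= n)%N] by near: n.
  have /andP[_ tn] := t_bounds n n1.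
  have hX := X_haar n n1.
  have hX' : haar_random_matrix (P n)
      (fun j : 'I_n => initial n (stair_height d (t n) n j)) (X n).
    by rewrite (_ : (fun j => _) = staircase d (t n) (n := n))//;
       apply/funext => j; rewrite staircaseE.
  rewrite (cok_prob_exact p_prime pH (stair_height_le d0 tn)
    (stair_height_mono d0 tn) hX').
  by rewrite stair_productE// sum_gen_staircase.
apply: cvg_trans; first by apply: near_eq_cvg; near=> n; symmetry; near: n; exact: PE.
apply: cvg_EFin; first by near=> n.
apply: cvgM; first exact: cvg_cst.
rewrite -[X in _ --> X]mul1r -[X in _ --> X]mulr1.
apply: cvgM => //; apply: cvgM => //.
exact: (cvg_comp _ _ m_cvg (cvg_CL_product p2)).
Unshelve. all: by end_near.
Qed.
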